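(* Let $(a_n)_n,(b_n)_n$ be sequences of nonnegative real numbers, $\alpha_n=a_n/n$, $\beta_n=b_n/n$, and assume $\alpha_n\to\alpha\in[0,\infty)$ and $\beta_n\to\beta\in[0,\infty)$ as $n\to\infty$. Then, as $n\to\infty$, $$\frac{1}{nf_n(x)}K_n^{a_n,b_n}\!\left(x+\frac{u}{nf_n(x)},\,x+\frac{v}{nf_n(x)}\right)=\frac{\sin\pi(u-v)}{\pi(u-v)}+O(n^{-1}),$$ uniformly for $x$ in any compact subset of $(r,s)$ and for $u,v$ in compact subsets of $\mathbb{R}$ (the right-hand quotient being understood as $1$ when $u=v$).
   Context: For $a,b\ge0$ let $w^{a,b}(x)=(1-x)^a(1+x)^b$ on $[-1,1]$, let $(p_j^{a,b})_{j\ge0}$ be the orthonormal polynomials for the measure $w^{a,b}(x)\mathbf 1_{[-1,1]}(x)\,dx$ ($\deg p_j^{a,b}=j$), and let $$K_n^{a,b}(x,y)=\sqrt{w^{a,b}(x)}\sqrt{w^{a,b}(y)}\sum_{j=0}^{n-1}p_j^{a,b}(x)p_j^{a,b}(y).$$ Define $$A_n=\frac{\alpha_n}{2+\alpha_n+\beta_n},\quad B_n=\frac{\beta_n}{2+\alpha_n+\beta_n},$$ $$D_n=\sqrt{(1+A_n+B_n)(1-A_n-B_n)(1-A_n+B_n)(1+A_n-B_n)},$$ $$\tilde r_n=B_n^2-A_n^2-D_n,\quad \tilde s_n=B_n^2-A_n^2+D_n,\quad r=\lim_n\tilde r_n,\quad s=\lim_n\tilde s_n,$$ $$f_n(x)=\frac{\sqrt{(x-\tilde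 r_n)(\tilde s_n-x)}}{\pi(1-A_n-B_n)(1-x^2)}.$$ *)

(* Defs.v *)
From HB Require Import structures.
From mathcomp Require Import all_boot all_order all_algebra.
From mathcomp Require Import all_classical all_reals all_analysis.

Set Implicit Arguments.
Unset Strict Implicit.
Unset Printing Implicit Defensive.

Import Order.TTheory GRing.Theory Num.Theory.
Import numFieldNormedType.Exports.

Local Open Scope classical_set_scope.
Local Open Scope ring_scope.

(* Meaningful for x in [-1, 1] only: powR takes junk values at negative bases. *)
Definition jacobi_weight (R : realType) (a b x : R) : R :=
  (1 - x) `^ a * (1 + x) `^ b.

(* Orthonormality for w^{a,b} 1_[-1,1] dx determines each p j up to sign; the
   kernel below does not depend on the choice of signs. *)
Definition jacobi_orthonormal (R : realType) (a b : R) (p : nat -> {poly R}) : Prop :=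
  (forall j, size (p j) = j.+1) /\
  (forall i j,
    (\int[@lebesgue_measure R]_(x in `[(-1)%R, 1%R])
        ((p i).[x] * (p j).[x] * jacobi_weight a b x)%:E = (i == j)%:R%:E)%E).

Definition jacobi_kernel (R : realType) (a b : R) (p : nat -> {poly R})
    (n : nat) (x y : R) : R :=
  Num.sqrt (jacobi_weight a b x) * Num.sqrt (jacobi_weight a b y) *
  \sum_(j < n) (p j).[x] * (p j).[y].

Section Density.
Variables (R : realType) (a b : nat -> R).

Definition alpha_seq (n : nat) : R := a n / n%:R.
Definition beta_seq (n : nat) : R := b n / n%:R.

Definition A_seq (n : nat) : R := alpha_seq n / (2 + alpha_seq n + beta_seq n).
Definition B_seq (n : nat) : R := beta_seq n / (2 + alpha_seq n + beta_seq n).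

Definition D_seq (n : nat) : R :=
  let A := A_seq n in let B := B_seq n in
  Num.sqrt ((1 + A + B) * (1 - A - B) * (1 - A + B) * (1 + A - B)).

Definition r_seq (n : nat) : R := B_seq n ^+ 2 - A_seq n ^+ 2 - D_seq n.
Definition s_seq (n : nat) : R := B_seq n ^+ 2 - A_seq n ^+ 2 + D_seq n.

Definition r_lim : R := limn r_seq.
Definition s_lim : R := limn s_seq.

Definition f_seq (n : nat) (x : R) : R :=
  Num.sqrt ((x - r_seq n) * (s_seq n - x)) /
  (pi * (1 - A_seq n - B_seq n) * (1 - x ^+ 2)).

End Density.

Definition sinc (R : realType) (t : R) : R :=
  if t == 0 then 1 else sin (pi * t) / (pi * t).

(* Main.v *)
Require Import Defs.
From HB Require Import structures.
From mathcomp Require Import all_boot all_order all_algebra ring lra zify.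
From mathcomp Require Import all_classical all_reals all_analysis.

Set Implicit Arguments.
Unset Strict Implicit.
Unset Printing Implicit Defensive.

Import Order.TTheory GRing.Theory Num.Theory.
Import numFieldNormedType.Exports.

Local Open Scope classical_set_scope.
Local Open Scope ring_scope.

(* With [psi = sqrt w p_n] and [eta = (1 - x^2) psi'] the Jacobi differential
   equation is the system [(1 - x^2) psi' = eta], [(1 - x^2) eta' = - V psi], where
   [V = k^2 P + k (1 - x^2)], [k = n + (a_n + b_n) / 2] and
   [P = (x - r_n) (s_n - x)]; moreover [n f_n = k sqrt P / (pi (1 - x^2))].
   Eliminating [p_(n-1)] from the Christoffel-Darboux formula gives
   [(2 k + 1) K_n(x, t) = (psi(x) eta(t) - eta(x) psi(t)) / (x - t) - k psi(x) psi(t)].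
   On the scale [1 / n] the system is, up to [O(1 / n)], a rotation of frequency
   [pi n f_n], so that [K_n] is a multiple of the sine kernel with a factor given
   by the energy [E = eta^2 + V psi^2].

   The size of [E] in the bulk comes from the normalization [int psi^2 = 1]. Put
   [d = (1 - x^2) d/dx]. For any [G], the function
   [G E - dG psi eta + ddG psi^2 / 2] vanishes at [-1] and [1], and its derivative is
   [(2 V G' + V' G + (ddG)' / 2) psi^2], which is [(k^2 + O(k)) psi^2] when
   [2 P G' + P' G = 1]. Integrate it over [-1, x] with the solution [G] that is
   smooth at the turning point [r_n], and over [x, 1] with the one that is smooth at
   [s_n]: these two solutions differ by [pi / (2 sqrt P)], whence
   [E = 2 k^2 sqrt P / pi + O(k)], with no asymptotics at the turning points or at
   the endpoints. *)

(** * Differentiation rules *)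

Section Calculus.
Variable R : realType.
Implicit Types (f g : R -> R) (x : R).

Lemma is_derive_val f x d e : is_derive x 1 f d -> d = e -> is_derive x 1 f e.
Proof. by move=> + <-. Qed.

Lemma is_derive_const (c : R) x : is_derive x 1 (fun=> c) 0.
Proof. exact: is_derive_cst. Qed.

Lemma is_derive_var x : is_derive x 1 (fun t : R => t) 1.
Proof. exact: is_derive_id. Qed.

Lemma is_derive_add f g x d e : is_derive x 1 f d -> is_derive x 1 g e ->
  is_derive x 1 (fun t => f t + g t) (d + e).
Proof. by move=> df dg; exact: is_deriveD. Qed.

Lemma is_derive_opp f x d : is_derive x 1 f d ->
  is_derive x 1 (fun t => - f t) (- d).
Proof. by move=> df; exact: is_deriveN. Qed.

Lemma is_derive_mul f g x d e : is_derive x 1 f d -> is_derive x 1 g e ->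
  is_derive x 1 (fun t => f t * g t) (d * g x + f x * e).
Proof.
move=> df dg; apply: (is_derive_val (is_deriveM df dg)).
by rewrite /GRing.scale/= addrC (mulrC d).
Qed.

Lemma is_derive_expn f n x d : is_derive x 1 f d ->
  is_derive x 1 (fun t => f t ^+ n) (n%:R * f x ^+ n.-1 * d).
Proof.
move=> df; have -> : (fun t => f t ^+ n) = f ^+ n.
  by apply/funext => t; rewrite exprfctE.
exact: is_derive_val (is_deriveX n df) _.
Qed.

(** The form with [n.+1] keeps [.-1] out of the computed derivatives. *)
Lemma is_derive_exp f n x d : is_derive x 1 f d ->
  is_derive x 1 (fun t => f t ^+ n.+1) (n.+1%:R * f x ^+ n * d).
Proof. exact: is_derive_expn. Qed.

Lemma is_derive_inv f x d : f x != 0 -> is_derive x 1 f d ->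
  is_derive x 1 (fun t => (f t)^-1) (- d / f x ^+ 2).
Proof.
move=> f0 df; apply: (is_derive_val (is_deriveV f0 df)).
by rewrite /GRing.scale/= !mulNr mulrC.
Qed.

Lemma is_derive_horner (q : {poly R}) x :
  is_derive x 1 (fun t => q.[t]) q^`().[x].
Proof. exact: is_derive_poly. Qed.

Lemma is_derive_sin_comp f x d : is_derive x 1 f d ->
  is_derive x 1 (fun t => sin (f t)) (cos (f x) * d).
Proof. move=> df; exact: (is_derive1_comp (is_derive_sin _) df). Qed.

Lemma is_derive_cos_comp f x d : is_derive x 1 f d ->
  is_derive x 1 (fun t => cos (f t)) (- sin (f x) * d).
Proof. move=> df; exact: (is_derive1_comp (is_derive_cos _) df). Qed.

Lemma is_derive_atan_comp f x d : is_derive x 1 f d ->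
  is_derive x 1 (fun t => atan (f t)) ((1 + f x ^+ 2)^-1 * d).
Proof. move=> df; exact: (is_derive1_comp (is_derive1_atan _) df). Qed.

Lemma is_derive_sqrt_comp f x d : 0 < f x -> is_derive x 1 f d ->
  is_derive x 1 (fun t => Num.sqrt (f t)) (d / (2 * Num.sqrt (f x))).
Proof.
move=> f0 df; apply: is_derive_val (is_derive1_comp (is_derive1_sqrt f0) df) _.
by rewrite mulrC.
Qed.

Lemma is_derive_powR_comp f x d (c : R) : 0 < f x -> is_derive x 1 f d ->
  is_derive x 1 (fun t => f t `^ c) (c * f x `^ (c - 1) * d).
Proof.
move=> f0 df; exact: (is_derive1_comp (is_derive1_powR c f0) df).
Qed.

Lemma is_derive_derivable f x d : is_derive x 1 f d -> derivable f x 1.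
Proof. by move=> df; exact: ex_derive. Qed.

Lemma is_derive_cont f x d : is_derive x 1 f d -> {for x, continuous f}.
Proof.
by move=> df; apply: differentiable_continuous; apply/derivable1_diffP; exact: ex_derive.
Qed.

Lemma is_derive_lipschitz f (df : R -> R) (M c d : R) :
  (forall t, Num.min c d <= t <= Num.max c d -> is_derive t 1 f (df t)) ->
  (forall t, Num.min c d <= t <= Num.max c d -> `|df t| <= M) ->
  `|f d - f c| <= M * `|d - c|.
Proof.
wlog cd : c d / c <= d => [wl|].
  have [cd|dc] := orP (le_total c d); first exact: (wl c d cd).
  by rewrite minC maxC (distrC (f d)) (distrC d); exact: (wl d c dc).
rewrite (min_idPl cd) (max_idPr cd) => h1 h2.
have [| |e ecd ->] := @MVT_segment R f df c d cd.
- by move=> t /[!in_itv]/= /andP[/ltW ct /ltW td]; apply: h1; rewrite ct.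
- apply: derivable_within_continuous => t tcd; apply: (@ex_derive _ _ _ _ _ _ _ (h1 _ _)).
  by move: tcd; rewrite in_itv.
by rewrite normrM ler_wpM2r// h2//; move: ecd; rewrite in_itv.
Qed.

End Calculus.

(* [notypeclasses refine] keeps the [is_derive] premises from being discharged by
   the library instances, whose derivatives mention [*:] and [%:A]. *)
Ltac is_derive_rec :=
  lazymatch goal with
  | |- is_derive _ _ (fun t => @?f t + @?g t) _ =>
      notypeclasses refine (@is_derive_add _ f g _ _ _ _ _); is_derive_rec
  | |- is_derive _ _ (fun t => - @?f t) _ =>
      notypeclasses refine (@is_derive_opp _ f _ _ _); is_derive_rec
  | |- is_derive _ _ (fun t => @?f t * @?g t) _ =>
      notypeclasses refine (@is_derive_mul _ f g _ _ _ _ _); is_derive_rec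
  | |- is_derive _ _ (fun t => @?f t ^+ _) _ =>
      first [notypeclasses refine (@is_derive_exp _ f _ _ _ _)
        | notypeclasses refine (@is_derive_expn _ f _ _ _ _)]; is_derive_rec
  | |- is_derive _ _ (fun t => (@?f t)^-1) _ =>
      first [notypeclasses refine (is_derive_const _ _)
            | notypeclasses refine (@is_derive_inv _ f _ _ _ _); [|is_derive_rec]]
  | |- is_derive _ _ (fun t => sin (@?f t)) _ =>
      notypeclasses refine (@is_derive_sin_comp _ f _ _ _); is_derive_rec
  | |- is_derive _ _ (fun t => cos (@?f t)) _ =>
      notypeclasses refine (@is_derive_cos_comp _ f _ _ _); is_derive_rec
  | |- is_derive _ _ (fun t => atan (@?f t)) _ =>
      notypeclasses refine (@is_derive_atan_comp _ f _ _ _); is_derive_rec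
  | |- is_derive _ _ (fun t => Num.sqrt (@?f t)) _ =>
      notypeclasses refine (@is_derive_sqrt_comp _ f _ _ _ _); [|is_derive_rec]
  | |- is_derive _ _ (fun t => @?f t `^ ?c) _ =>
      notypeclasses refine (@is_derive_powR_comp _ f _ _ c _ _); [|is_derive_rec]
  | |- is_derive _ _ (fun t => t) _ => notypeclasses refine (is_derive_var _)
  | |- is_derive _ _ (fun t => ?q.[t]) _ => notypeclasses refine (is_derive_horner _ _)
  | |- is_derive _ _ (fun t => ?h t) _ => try (change (fun t => h t) with h; eassumption)
  | |- is_derive _ _ (fun t => ?c) _ => notypeclasses refine (is_derive_const _ _)
  | |- _ => try eassumption
  end.
Ltac is_derive_tac := notypeclasses refine (is_derive_val _ _); [is_derive_rec|]; cbv beta.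
Ltac derivable_tac := notypeclasses refine (@is_derive_derivable _ _ _ _ _); is_derive_rec.

(** * Orthonormal polynomials for a functional with the Jacobi integration by parts *)

Section OrthonormalPolynomials.
Variables (R : realFieldType) (I : {poly R} -> R) (p : nat -> {poly R}).
Hypothesis ID : forall f g, I (f + g) = I f + I g.
Hypothesis IZ : forall c f, I (c *: f) = c * I f.
Hypothesis size_p : forall j, size (p j) = j.+1.
Hypothesis Ip : forall i j, I (p i * p j) = (i == j)%:R.

Lemma functional0 : I 0 = 0.
Proof. by rewrite -(scale0r 0) IZ mul0r. Qed.

Lemma functionalN f : I (- f) = - I f.
Proof. by rewrite -scaleN1r IZ mulN1r. Qed.

Lemma functionalB f g : I (f - g) = I f - I g.
Proof. by rewrite ID functionalN. Qed.

Lemma functional_sum n (F : 'I_n -> {poly R}) :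
  I (\sum_(i < n) F i) = \sum_(i < n) I (F i).
Proof. exact: (big_morph I ID functional0). Qed.

Lemma lead_coef_p_neq0 n : (p n)`_n != 0.
Proof.
have := size_p n; rewrite -[X in (p n)`_X]/(n.+1.-1) => <-.
by rewrite -lead_coefE lead_coef_eq0 -size_poly_eq0 size_p.
Qed.

Lemma size_sub_lead n (q : {poly R}) : (size q <= n.+1)%N ->
  (size (q - (q`_n / (p n)`_n) *: p n)%R <= n)%N.
Proof.
move=> sq; apply/leq_sizeP => j; rewrite leq_eqVlt => /predU1P[<-|nj].
  by rewrite coefB coefZ divfK ?subrr// lead_coef_p_neq0.
by rewrite coefB coefZ ![_`_j]nth_default ?mulr0 ?subr0 ?size_p ?(leq_trans sq nj).
Qed.

Lemma orthonormal_expansion n (q : {poly R}) : (size q <= n)%N ->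
  q = \sum_(j < n) I (q * p j) *: p j.
Proof.
move=> sq.
(* Any expansion will do: pairing it with [p j] identifies its coefficients. *)
suff [c qE] : exists c : nat -> R, q = \sum_(j < n) c j *: p j.
  rewrite [LHS]qE; apply: eq_bigr => j _; congr (_ *: _).
  rewrite qE mulr_suml functional_sum (bigD1 j)//= big1 ?addr0.
    by rewrite -scalerAl IZ Ip eqxx mulr1.
  by move=> i ij; rewrite -scalerAl IZ Ip -val_eqE/= in ij *; rewrite (negbTE ij) mulr0.
elim: n q sq => [|n IHn] q sq.
  by exists (fun=> 0); rewrite big_ord0; apply/eqP; rewrite -size_poly_leq0.
have [c cE] := IHn _ (size_sub_lead sq).
exists (fun j => if j == n then q`_n / (p n)`_n else c j).
rewrite big_ord_recr/= eqxx; apply/eqP; rewrite -subr_eq cE; apply/eqP.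
by apply: eq_bigr => j _; rewrite ltn_eqF.
Qed.

Lemma orthogonal_lower n (q : {poly R}) : (size q <= n)%N -> I (p n * q) = 0.
Proof.
move=> sq; rewrite (orthonormal_expansion sq) mulr_sumr functional_sum big1// => j _.
by rewrite -scalerAr IZ Ip gtn_eqF ?mulr0.
Qed.

Lemma functional_lead n (q : {poly R}) : (size q <= n.+1)%N ->
  I (p n * q) = q`_n / (p n)`_n.
Proof.
move=> /size_sub_lead /orthogonal_lower.
rewrite mulrBr functionalB -scalerAr IZ Ip eqxx mulr1 => /eqP.
by rewrite subr_eq0 => /eqP.
Qed.

(** * Integration by parts, the Jacobi equation and the Christoffel-Darboux formula *)

Variables (a b : R).
Let l : {poly R} := (b - a)%:P - (a + b) *: 'X.
Hypothesis IBP : forall q : {poly R},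
  I ((1 - 'X^2) * q^`() + (l - 2 *: 'X) * q) = 0.

(** Since [l = (1 - x^2) w' / w], this is [((1 - x^2) w q')' / w], while [IBP] says that
    [((1 - x^2) w q)'] has integral zero. *)
Definition jacobi_op (q : {poly R}) : {poly R} :=
  (1 - 'X^2) * q^`()^`() + (l - 2 *: 'X) * q^`().

(** One integration by parts gives the symmetric form [- I ((1 - X^2) q1' q2')]. *)
Lemma jacobi_op_sym q1 q2 : I (jacobi_op q1 * q2) = I (q1 * jacobi_op q2).
Proof.
have h (f g : {poly R}) : I (jacobi_op f * g) = - I ((1 - 'X^2) * f^`() * g^`()).
  apply/eqP; rewrite -subr_eq0 opprK -ID -(IBP (f^`() * g)); apply/eqP; congr I.
  rewrite /jacobi_op derivM; ring.
by rewrite h (mulrC q1) h -mulrA (mulrC q1^`()) mulrA.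
Qed.

Lemma coef_deriv_sq_jacobi (q : {poly R}) m :
  ((1 - 'X^2) * q)`_m.+1 = q`_m.+1 - (if m is k.+1 then q`_k else 0).
Proof.
rewrite mulrBl mul1r coefB -commr_polyXn coefMXn.
by case: m => [|m]//=; rewrite subn2.
Qed.

Lemma coef_linear_mul (c d : R) (q : {poly R}) m :
  ((c%:P - d *: 'X) * q)`_m = c * q`_m - d * (if m is k.+1 then q`_k else 0).
Proof.
rewrite mulrBl coefB -scalerAl coefZ -commr_polyX coefMX coefCM.
by case: m.
Qed.

Lemma l_sub2X : l - 2 *: 'X = (b - a)%:P - (a + b + 2) *: 'X.
Proof. by rewrite /l -addrA -opprD -scalerDl. Qed.

(** The operator is triangular in the monomial basis, and its diagonal entries [- j (j + a + b + 1)]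
    are the eigenvalues. *)
Lemma coef_jacobi_op (q : {poly R}) j : (jacobi_op q)`_j =
  q`_j.+2 * (j.+2%:R * j.+1%:R) + (b - a) * (q`_j.+1 * j.+1%:R)
  - j%:R * (j%:R + a + b + 1) * q`_j.
Proof.
rewrite /jacobi_op l_sub2X coefD coef_linear_mul.
case: j => [|[|j]].
- rewrite mulrBl mul1r coefB coefXnM/= !coef_deriv; ring.
- rewrite coef_deriv_sq_jacobi !coef_deriv; ring.
- rewrite coef_deriv_sq_jacobi !coef_deriv; ring.
Qed.

Lemma size_jacobi_op (q : {poly R}) : (size (jacobi_op q) <= size q)%N.
Proof.
apply/leq_sizeP => j mj; rewrite coef_jacobi_op.
have q0 k : (j <= k)%N -> q`_k = 0 by move=> jk; exact/nth_default/(leq_trans mj).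
by rewrite !q0 ?leqW//; ring.
Qed.

(** The residual has degree below [n], since the leading terms cancel. By symmetry it is orthogonal
    to each [p j] with [j < n], because the operator does not raise degrees. *)
Lemma jacobi_ode n :
  jacobi_op (p n) = - (n%:R * (n%:R + a + b + 1)) *: p n.
Proof.
set e := - _; pose r := jacobi_op (p n) - e *: p n.
have r0 : (size r <= n)%N.
  apply/leq_sizeP => j nj; rewrite coefB coefZ coef_jacobi_op.
  rewrite ![(p n)`__.+1]nth_default ?size_p; try lia.
  move: nj; rewrite leq_eqVlt => /predU1P[<-|nj]; first by rewrite /e; ring.
  by rewrite nth_default ?size_p//; ring.
suff : r = 0 by move/eqP; rewrite subr_eq0 => /eqP.
rewrite (orthonormal_expansion r0) big1// => j _.
rewrite mulrBl functionalB jacobi_op_sym -scalerAl IZ Ip.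
rewrite gtn_eqF// mulr0 subr0 orthogonal_lower ?scale0r//.
by rewrite (leq_trans (size_jacobi_op _))// size_p.
Qed.

(** The summand [n X p_n] cancels the term of degree [n + 1]. For [n > 0] the result is a
    combination of [p_n] and [p_(n-1)], so it can replace [p_(n-1)] in the Christoffel-Darboux
    formula. *)
Definition cd_partner (n : nat) : {poly R} :=
  (1 - 'X^2) * (p n)^`() + n%:R *: ('X * p n).

(** Integration by parts moves the derivative from [p n.+1] to [q]. There remains [p n.+1] against a
    polynomial [H] of degree at most [n.+1], of which only the top coefficient counts. *)
Lemma cd_partner_lead n (q : {poly R}) : (size q <= n.+1)%N ->
  I (cd_partner n.+1 * q) = (2 * n.+1%:R + 1 + a + b) * (q`_n / (p n.+1)`_n.+1).
Proof.
move=> sq.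
pose H := n.+1%:R *: ('X * q) - ((1 - 'X^2) * q^`() + (l - 2 *: 'X) * q).
have -> : I (cd_partner n.+1 * q) = I (p n.+1 * H).
  apply/eqP; rewrite -subr_eq0 -functionalB -(IBP (p n.+1 * q)); apply/eqP; congr I.
  rewrite /H /cd_partner derivM; rewrite -!mul_polyC; ring.
have HE j : H`_j.+1 = (2 * n.+1%:R + 1 + a + b) * q`_j
   + (j%:R - n%:R) * q`_j - q`_j.+2 * j.+2%:R - (b - a) * q`_j.+1.
  rewrite /H coefB coefZ coefXM/= coefD coef_deriv_sq_jacobi l_sub2X coef_linear_mul.
  case: j => [|j]; rewrite !coef_deriv; ring.
have szH : (size H <= n.+2)%N.
  apply/leq_sizeP => -[|j]//; rewrite ltnS => nj.
  by rewrite HE !nth_default; [ring|apply: (leq_trans sq); lia..].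
rewrite functional_lead// HE subrr mul0r addr0.
by rewrite ![q`_ _.+1]nth_default ?(leq_trans sq)//; ring.
Qed.

(** The factor [*+ (0 < m)] is for constant [f], where the quotient is zero but the coefficient of
    [f] need not be. *)
Lemma div_XsubC (f : {poly R}) m z : (size f <= m.+1)%N ->
  exists2 t, f - f.[z]%:P = t * ('X - z%:P) & (size t <= m)%N /\ t`_m.-1 = f`_m *+ (0 < m).
Proof.
move=> sf; have /factor_theorem[t tE] : root (f - f.[z]%:P) z.
  by rewrite /root !hornerE subrr.
have st : (size t <= m)%N.
  have [->|t0] := eqVneq t 0; first by rewrite size_poly0.
  have : (size (t * ('X - z%:P))%R <= m.+1)%N.
    rewrite -tE (leq_trans (size_polyD _ _))// size_polyN geq_max sf.
    by rewrite (leq_trans (size_polyC_leq1 _)).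
  by rewrite size_Mmonic ?monicXsubC// size_XsubC addn2.
exists t => //; split => //.
case: m sf st => [|m] sf st; first by rewrite mulr0n nth_default.
have := congr1 (fun h : {poly R} => h`_m.+1) tE.
rewrite coefB coefC/= subr0 mulrBr coefB coefMX coefMC/=.
by rewrite [t`_m.+1]nth_default// mul0r subr0 => ->.
Qed.

Lemma size_cd_partner n : (size (cd_partner n) <= n.+1)%N.
Proof.
apply/leq_sizeP => -[|j]// nj; rewrite /cd_partner coefD coefZ coefXM/=.
rewrite coef_deriv_sq_jacobi !coef_deriv [(p n)`_j.+2]nth_default ?size_p; last lia.
case: j nj => [|j] nj.
  by move: nj; rewrite ltnS leqn0 => /eqP ->; rewrite mul0rn; ring.
rewrite coef_deriv mul0rn; move: nj; rewrite ltnS leq_eqVlt => /predU1P[->|nj].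
  ring.
by rewrite nth_default ?size_p// mul0rn; ring.
Qed.

(* The quotient of the left-hand side by [X - z] has degree less than [n]; its
   inner product with [p j] only involves [p j].[z], because [p n] and its
   partner are orthogonal to all polynomials of degree less than [n - 1]. *)
Lemma christoffel_darboux_poly n z : (0 < n)%N ->
  (cd_partner n).[z] *: p n - (p n).[z] *: cd_partner n =
  (2 * n%:R + 1 + a + b) *:
    (('X - z%:P) * \sum_(j < n) (p j).[z] *: p j).
Proof.
case: n => [//|n] _.
set g := cd_partner n.+1; set N := LHS.
have [P1 P1E [sP1 lP1]] := div_XsubC z (eq_leq (size_p n.+1)).
have [G1 G1E [sG1 _]] := div_XsubC z (size_cd_partner n.+1).
pose Q := g * P1 - p n.+1 * G1.
have NE : N = ('X - z%:P) * Q.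
  rewrite /N /Q mulrBr !(mulrCA ('X - _)) !(mulrC ('X - _)) -P1E -G1E -/g -!mul_polyC; ring.
have IQ (t : {poly R}) : (size t <= n)%N -> I (('X - z%:P) * Q * t) = 0.
  move=> st; rewrite -NE /N mulrBl functionalB -!scalerAl !IZ orthogonal_lower.
    by rewrite cd_partner_lead ?[t`_n]nth_default ?(leq_trans st)// !(mul0r, mulr0, subrr).
  by rewrite (leq_trans st).
have IQ1 : I Q = 2 * n.+1%:R + 1 + a + b.
  rewrite /Q functionalB cd_partner_lead// orthogonal_lower// subr0.
  by rewrite lP1 mulr1n divff ?mulr1// lead_coef_p_neq0.
have sQ : (size Q <= n.+1)%N.
  have [->|Q0] := eqVneq Q 0; first by rewrite size_poly0.
  have : (size (('X - z%:P) * Q)%R <= n.+2)%N.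
    rewrite -NE (leq_trans (size_polyD _ _))// size_polyN geq_max.
    rewrite !(leq_trans (size_scale_leq _ _)) ?size_p//.
    exact: size_cd_partner.
  by rewrite mulrC size_Mmonic ?monicXsubC// size_XsubC addn2.
rewrite NE {1}(orthonormal_expansion sQ) scalerAr scaler_sumr; congr (_ * _).
apply: eq_bigr => j _; rewrite scalerA; congr (_ *: _).
have [t tE [st _]] := div_XsubC z (eq_leq (size_p j)).
have -> : Q * p j = (p j).[z] *: Q + ('X - z%:P) * Q * t.
  by rewrite -{1}(subrK (p j).[z]%:P (p j)) tE -mul_polyC; ring.
rewrite ID IZ IQ1 IQ ?addr0; first by rewrite mulrC.
by rewrite (leq_trans st)// -ltnS ltn_ord.
Qed.

Lemma christoffel_darboux n x z : (0 < n)%N ->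
  (2 * n%:R + 1 + a + b) * ((x - z) * \sum_(j < n) (p j).[x] * (p j).[z]) =
  (p n).[x] * (cd_partner n).[z] - (cd_partner n).[x] * (p n).[z].
Proof.
move=> n0; have := congr1 (fun f => f.[x]) (christoffel_darboux_poly z n0).
rewrite hornerD hornerN !hornerZ hornerM hornerXsubC horner_sum => E.
rewrite (mulrC (p n).[x]) (mulrC _ (p n).[z]) E.
by congr (_ * (_ * _)); apply: eq_bigr => j _; rewrite hornerZ mulrC.
Qed.

(** Differentiating the polynomial identity and evaluating at [z = x] removes the factor [X - z]. *)
Lemma christoffel_darboux_diag n x : (0 < n)%N ->
  (2 * n%:R + 1 + a + b) * \sum_(j < n) (p j).[x] * (p j).[x] =
  (p n)^`().[x] * (cd_partner n).[x] - (cd_partner n)^`().[x] * (p n).[x].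
Proof.
move=> n0; have := congr1 (fun f => f^`().[x]) (christoffel_darboux_poly x n0).
move: (cd_partner n) => g; rewrite derivB !derivZ derivM derivXsubC mul1r hornerD hornerN !hornerZ.
rewrite hornerD hornerM hornerXsubC subrr mul0r addr0 horner_sum => E.
rewrite (mulrC _ (p n).[x]) (mulrC _ g.[x]) E.
by congr (_ * _); apply: eq_bigr => j _; rewrite hornerZ.
Qed.

End OrthonormalPolynomials.

(** * The Jacobi weight *)

Section Weight.
Variable R : realType.
Implicit Types (x a b : R).

(** Clamping the base at zero gives a function continuous on the whole line; on [-1, 1] the weight
    is a product of two such functions. *)
Lemma continuous_powR_max a x : 0 <= a ->
  Num.max t 0 `^ a @[t --> x] --> Num.max x 0 `^ a.
Proof.
rewrite le_eqVlt => /predU1P[<-|a0].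
  by under eq_fun do rewrite powRr0; rewrite powRr0; exact: (is_derive_cont (is_derive_const 1 x)).
have [x0|[x0|x0]] : x < 0 \/ 0 < x \/ x = 0.
  by case: (ltgtP x 0) => x0; [left|right; left|right; right].
- rewrite (_ : Num.max x 0 `^ a = 0); last by rewrite (max_idPr (ltW x0)) powR0// gt_eqF.
  apply: (@cvg_trans _ ((fun=> 0 : R) t @[t --> x])); last first.
    exact: (is_derive_cont (is_derive_const 0 x)).
  apply: near_eq_cvg; near=> t.
  rewrite (max_idPr _) ?powR0 ?gt_eqF// ltW//.
  by near: t; exact: lt_nbhsl.
- rewrite (_ : Num.max x 0 = x); last by rewrite (max_idPl (ltW x0)).
  apply: (@cvg_trans _ ((fun t => t `^ a) @ x)); last first.
    exact: (is_derive_cont (is_derive1_powR a x0)).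
  apply: near_eq_cvg; near=> t.
  rewrite (max_idPl _)// ltW//.
  by near: t; exact: lt_nbhsr.
- rewrite x0 maxxx powR0 ?gt_eqF//.
  apply/cvgrPdist_le => e e0; near=> t.
  rewrite sub0r normrN ger0_norm ?powR_ge0//.
  have -> : e = (e `^ a^-1) `^ a by rewrite -powRrM mulVf ?gt_eqF// powRr1// ltW.
  apply: ge0_ler_powR; rewrite ?nnegrE ?powR_ge0 ?le_max ?lexx ?orbT ?(ltW a0)//.
  rewrite ge_max powR_ge0 andbT ltW//.
  near: t; apply: lt_nbhsl; exact: powR_gt0.
Unshelve. all: by end_near. Qed.

Lemma weight_ge0 a b x : 0 <= jacobi_weight a b x.
Proof. by rewrite mulr_ge0// powR_ge0. Qed.

Lemma weight_gt0 a b x : -1 < x < 1 -> 0 < jacobi_weight a b x.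
Proof. by move=> /andP[x1 x2]; rewrite mulr_gt0// powR_gt0//; lra. Qed.

Lemma within_continuous_weight a b : 0 <= a -> 0 <= b ->
  {within `[(-1 : R), 1], continuous (jacobi_weight a b)}.
Proof.
move=> a0 b0.
pose v t := Num.max (1 - t) 0 `^ a * Num.max (1 + t) 0 `^ b.
have cv : continuous v.
  move=> x.
  have h (g : R -> R) d c : 0 <= c -> is_derive x 1 g d ->
      Num.max (g t) 0 `^ c @[t --> x] --> Num.max (g x) 0 `^ c.
    move=> c0 /is_derive_cont gx.
    exact: (cvg_comp g (fun u => Num.max u 0 `^ c) gx (@continuous_powR_max c (g x) c0)).
  apply: cvgM.
    exact: (h _ _ _ a0 (is_derive_add (is_derive_const 1 x) (is_derive_opp (is_derive_var x)))).
  exact: (h _ _ _ b0 (is_derive_add (is_derive_const 1 x) (is_derive_var x))).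
apply: (@subspace_eq_continuous _ _ _ v); last exact: continuous_subspaceT.
move=> x; rewrite inE/= in_itv/= => /andP[x1 x2].
by rewrite /v /jacobi_weight !(max_idPl _)//; lra.
Qed.

Lemma is_derive_weight a b x : -1 < x < 1 ->
  is_derive x 1 (jacobi_weight a b)
    (jacobi_weight a b x * (b - a - (a + b) * x) / (1 - x ^+ 2)).
Proof.
move=> /andP[x1 x2].
have p1 : 0 < 1 - x by lra.
have p2 : 0 < 1 + x by lra.
have e (u c : R) : 0 < u -> u `^ (c - 1) = u `^ c / u.
  by move=> u0; rewrite powRB ?(gt_eqF u0) ?implybT// powRr1// ltW.
rewrite /jacobi_weight; is_derive_tac => //.
rewrite !e//.
have -> : 1 - x ^+ 2 = (1 - x) * (1 + x) by ring.
rewrite /jacobi_weight; field; rewrite !gt_eqF//=.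
Qed.

End Weight.

(** * Integration against the Jacobi weight *)

Section JacobiFunctional.
Variable R : realType.
Local Notation mu := (@lebesgue_measure R).

(** Derivatives are required only in the interior, since the weight need not be differentiable at
    [-1] and [1]. *)
Lemma Rintegral_FTC2 (f F : R -> R) (c d : R) : c < d ->
  {within `[c, d], continuous f} -> {within `[c, d], continuous F} ->
  (forall x, c < x < d -> is_derive x 1 F (f x)) ->
  \int[mu]_(x in `[c, d]) f x = F d - F c.
Proof.
move=> cd cf cF dF; rewrite /Rintegral.
have [_ F1 F2] := (continuous_within_itvP F cd).1 cF.
rewrite (continuous_FTC2 cd cf (F := F))//.
  split => // x; rewrite in_itv/= => /dF h; exact: ex_derive.
by move=> x; rewrite in_itv/= => /dF h; rewrite derive1E derive_val.
Qed.

Variables (a b : R) (a0 : 0 <= a) (b0 : 0 <= b).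
Local Notation w := (jacobi_weight a b).

Lemma within_continuous_horner_weight (q : {poly R}) (D : set R) :
  D `<=` `[-1, 1] ->
  {within D, continuous (fun x => q.[x] * w x)}.
Proof.
move=> D1; apply: (continuous_subspaceW D1) => x; apply: cvgM.
  exact: (continuous_subspaceT (@continuous_horner _ q)).
exact: (within_continuous_weight a0 b0).
Qed.

Lemma integrable_horner_weight (q : {poly R}) (c d : R) : -1 <= c -> d <= 1 ->
  mu.-integrable `[c, d] (EFin \o (fun x => q.[x] * w x)).
Proof.
move=> c1 d1; apply: continuous_compact_integrable; first exact: segment_compact.
apply: within_continuous_horner_weight.
by move=> x /=; rewrite !in_itv/= => /andP[? ?]; apply/andP; split; lra.
Qed.

Definition jacobi_functional (q : {poly R}) : R :=
  \int[mu]_(x in `[-1, 1]) (q.[x] * w x).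
Local Notation I := jacobi_functional.

Lemma jacobi_functionalD f g : I (f + g) = I f + I g.
Proof.
rewrite /I -RintegralD//; try exact: integrable_horner_weight.
by apply: eq_Rintegral => x _; rewrite hornerD mulrDl.
Qed.

Lemma jacobi_functionalZ c f : I (c *: f) = c * I f.
Proof.
rewrite /I -RintegralZl//; try exact: integrable_horner_weight.
by apply: eq_Rintegral => x _; rewrite hornerZ -mulrA.
Qed.

(** The integrand is the derivative of [(1 - x^2) q w], which vanishes at both endpoints. *)
Lemma jacobi_functional_IBP (q : {poly R}) :
  I ((1 - 'X^2) * q^`() + (((b - a)%:P - (a + b) *: 'X) - 2 *: 'X) * q) = 0.
Proof.
apply: etrans; first apply: (@Rintegral_FTC2 _ (fun x => ((1 - 'X^2) * q).[x] * w x)).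
- lra.
- exact: within_continuous_horner_weight.
- exact: within_continuous_horner_weight.
- move=> x x1; have dw := is_derive_weight a b x1.
  is_derive_tac; rewrite derivM derivB derivXn !poly.derivE.
  rewrite !(hornerD, hornerN, hornerM, hornerZ, hornerC, hornerX, hornerXn, hornerMn).
  have x2 : 1 - x ^+ 2 != 0 by move/andP: x1 => [? ?]; apply: lt0r_neq0; nra.
  by field.
- by rewrite /= !(hornerD, hornerN, hornerM, hornerZ, hornerC, hornerX, hornerXn, hornerMn); ring.
Qed.

Variable p : nat -> {poly R}.
Hypothesis op : jacobi_orthonormal a b p.

Lemma jacobi_functional_orthonormal i j : I (p i * p j) = (i == j)%:R.
Proof.
have := op.2 i j; rewrite /I /Rintegral => /(congr1 fine) /= <-; congr fine.
by apply: eq_integral => x _; rewrite hornerM.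
Qed.

Definition jacobi_mass (n : nat) (x : R) : R :=
  \int[mu]_(t in `[-1, x]) ((p n * p n).[t] * w t).

Lemma jacobi_mass_left n : jacobi_mass n (-1) = 0.
Proof. by rewrite /jacobi_mass set_itv1 Rintegral_set1. Qed.

Lemma jacobi_mass_right n : jacobi_mass n 1 = 1.
Proof. by have := jacobi_functional_orthonormal n n; rewrite eqxx. Qed.

Lemma within_continuous_jacobi_mass n (c d : R) : -1 <= c -> d <= 1 ->
  {within `[c, d], continuous (jacobi_mass n)}.
Proof.
move=> c1 d1; have cd : `[c, d] `<=` `[-1, 1].
  by move=> x /=; rewrite !in_itv/= => /andP[? ?]; apply/andP; split; lra.
apply: (continuous_subspaceW cd).
apply: parameterized_integral_continuous; first lra.
exact: integrable_horner_weight.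
Qed.

Lemma is_derive_jacobi_mass n (x : R) : -1 < x < 1 ->
  is_derive x 1 (jacobi_mass n) ((p n).[x] ^+ 2 * w x).
Proof.
move=> x1; have [x1' x1''] := andP x1.
have ip := integrable_horner_weight (p n * p n) (lexx (-1)) (lexx 1).
have [|d1 d2] := continuous_FTC1_closed x1'' ip x1'.
  apply: cvgM; first exact: continuous_horner.
  exact: is_derive_cont (is_derive_weight a b x1).
apply: DeriveDef => //; rewrite -derive1E [LHS]d2 hornerM expr2//.
Qed.

End JacobiFunctional.

(** * Smooth solutions of [2 P G' + P' G = 1] *)

Section AffineKernel.
Variable R : realType.
Local Notation mu := (@lebesgue_measure R).

(** Index [k] is the [k]-th derivative of index [0] divided by [(-1)^k k!], so the family is closed
    under differentiation. *)
Definition affine_kernel (A B : {poly R}) (k : nat) (x : R) : R :=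
  \int[mu]_(s in `[0, 1]) (B.[s] ^+ k / (A.[s] + B.[s] * x) ^+ k.+1).

Variables (A B : {poly R}) (m : R).
Hypothesis m0 : 0 < m.
Hypothesis B1 : forall s, 0 <= s <= 1 -> `|B.[s]| <= 1.

Let f k x s := B.[s] ^+ k / (A.[s] + B.[s] * x) ^+ k.+1.

Lemma affine_kernel_dom k x s : 0 <= s <= 1 -> m <= A.[s] + B.[s] * x ->
  `|f k x s| <= (m^-1) ^+ k.+1.
Proof.
move=> s01 ms; have D0 := lt_le_trans m0 ms.
rewrite /f normrM normfV !normrX (gtr0_norm D0) -exprVn.
rewrite -[leRHS]mul1r; apply: ler_pM; rewrite ?exprn_ge0 ?invr_ge0 ?(ltW D0)//.
  by rewrite exprn_ile1// B1.
by rewrite lerXn2r ?nnegrE ?invr_ge0 ?(ltW D0) ?(ltW m0)// lef_pV2// posrE.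
Qed.

Lemma affine_kernel_integrable k x :
  (forall s, 0 <= s <= 1 -> m <= A.[s] + B.[s] * x) ->
  mu.-integrable `[0, 1] (EFin \o f k x).
Proof.
move=> mx; apply: continuous_compact_integrable; first exact: segment_compact.
apply: derivable_within_continuous => s; rewrite in_itv/= => s01.
have D0 := lt_le_trans m0 (mx s s01).
rewrite /f; derivable_tac.
by rewrite expf_neq0// gt_eqF.
Qed.

Lemma affine_kernel_bound k x :
  (forall s, 0 <= s <= 1 -> m <= A.[s] + B.[s] * x) ->
  `|affine_kernel A B k x| <= (m^-1) ^+ k.+1.
Proof.
move=> mx; have intf := affine_kernel_integrable k mx.
apply: (le_trans (le_normr_Rintegral _ intf)) => //.
have -> : (m^-1) ^+ k.+1 = \int[mu]_(s in `[0, 1]) ((m^-1) ^+ k.+1).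
  rewrite Rintegral_cst//= lebesgue_measure_itv/= lte_fin ltr01 -EFinD/= subr0 mulr1//.
apply: le_Rintegral => //=.
- exact: integrable_norm.
- apply: continuous_compact_integrable; first exact: segment_compact.
  by apply: continuous_subspaceT => s; exact: (is_derive_cont (is_derive_const _ s)).
- by move=> s; rewrite in_itv/= => s01; apply: affine_kernel_dom => //; exact: mx.
Qed.

Lemma is_derive_affine_kernel k (u v x : R) : u < x < v ->
  (forall s y, 0 <= s <= 1 -> u < y < v -> m <= A.[s] + B.[s] * y) ->
  is_derive x 1 (affine_kernel A B k) (- k.+1%:R * affine_kernel A B k.+1 x).
Proof.
move=> uxv mx.
have df y s : u < y < v -> 0 <= s <= 1 ->
    is_derive y 1 (f k ^~ s) (- k.+1%:R * f k.+1 y s).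
  move=> uyv s01; have D0 := lt_le_trans m0 (mx s y s01 uyv).
  rewrite /f; is_derive_tac; first by rewrite expf_neq0// gt_eqF.
  by rewrite !exprS; field; rewrite expf_neq0 gt_eqF.
have d1 y s : u < y < v -> 0 <= s <= 1 ->
    partial1of2 (f k) y s = - k.+1%:R * f k.+1 y s.
  by move=> uyv s01; rewrite partial1of2E; have h := df y s uyv s01; rewrite derive_val.
have xI : `]u, v[%classic x by rewrite /= in_itv.
have intf y : `]u, v[%classic y -> mu.-integrable `[0, 1] (EFin \o f k y).
  by rewrite /= in_itv/= => uyv; apply: affine_kernel_integrable => s s01; exact: mx.
have derf y s : `]u, v[%classic y -> `[0, 1]%classic s -> derivable (f k ^~ s) y 1.
  by rewrite /= !in_itv/= => uyv s01; have h := df y s uyv s01; exact: ex_derive.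
(* A constant dominating function: [|B| <= 1], and the denominators are at least [m] for every
   parameter in []u, v[]. *)
pose G (s : R) := k.+1%:R * (m^-1) ^+ k.+2.
have G0 s : 0 <= G s by rewrite mulr_ge0// exprn_ge0// invr_ge0 ltW.
have intG : mu.-integrable `[0, 1] (EFin \o G).
  apply: continuous_compact_integrable; first exact: segment_compact.
  by apply: continuous_subspaceT => s; exact: (is_derive_cont (is_derive_const _ s)).
have Gub y s : `]u, v[%classic y -> `[0, 1]%classic s -> `|partial1of2 (f k) y s| <= G s.
  rewrite /= !in_itv/= => uyv s01; rewrite d1// normrM normrN normr_nat /G.
  by rewrite ler_wpM2l//; apply: affine_kernel_dom => //; exact: mx.
have m01 : measurable (`[0%R, 1%R]%classic : set (measurableTypeR R)).
  exact: measurable_itv.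
apply: DeriveDef.
  exact: (derivable_under_integral m01 xI intf derf G0 intG Gub).
rewrite -derive1E (differentiation_under_integral m01 xI intf derf G0 intG Gub).
rewrite /affine_kernel -RintegralZl//; last first.
  by apply: affine_kernel_integrable => s s01; exact: mx.
by apply: eq_Rintegral => s; rewrite inE/= in_itv/= => s01; rewrite d1.
Qed.

End AffineKernel.

Section Gauge.
Variable R : realType.
Local Notation mu := (@lebesgue_measure R).

(** The last clause is [2 P G' + P' G = 1] with [P = (x - r) (s - x)]. Three derivatives are listed
    because [ddG] is differentiated once more. *)
Definition gauge (r s M lo hi : R) (G0 G1 G2 G3 : R -> R) : Prop :=
  forall x, lo <= x <= hi ->
  [/\ is_derive x 1 G0 (G1 x), is_derive x 1 G1 (G2 x), is_derive x 1 G2 (G3 x),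
      [/\ `|G0 x| <= M, `|G1 x| <= M, `|G2 x| <= M & `|G3 x| <= M] &
      2 * ((x - r) * (s - x)) * G1 x + (r + s - 2 * x) * G0 x = 1].

(** The map [x -> - x] exchanges the turning points: the solution smooth at one of them yields the
    solution smooth at the other. *)
Lemma gauge_reflect r s M lo hi G0 G1 G2 G3 : gauge r s M lo hi G0 G1 G2 G3 ->
  gauge (- s) (- r) M (- hi) (- lo) (fun x => - G0 (- x)) (fun x => G1 (- x))
    (fun x => - G2 (- x)) (fun x => G3 (- x)).
Proof.
move=> g x xlh; have [|d0 d1 d2 [b0 b1 b2 b3] e] := g (- x); first lra.
have h (G : R -> R) d : is_derive (- x) 1 G d -> is_derive x 1 (fun t => G (- t)) (- d).
  move=> dG; apply: (is_derive_val (is_derive1_comp dG (is_derive_opp (is_derive_var x)))).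
  exact: mulrN1.
split.
- by apply: is_derive_val (is_derive_opp (h _ _ d0)) _; rewrite opprK.
- exact: h.
- by apply: is_derive_val (is_derive_opp (h _ _ d2)) _; rewrite opprK.
- by rewrite !normrN.
- by rewrite -[RHS]e; ring.
Qed.

(* At [x < s] the index [k = 0] gives [int_0^1 dt / ((s - x) + t^2 (x - r))], which
   is smooth across [r]; the other indices give its derivatives up to constants. *)
Definition gauge_left (r s : R) : nat -> R -> R :=
  affine_kernel (s%:P - r *: 'X^2) ('X^2 - 1).

Let horner_den (r s t x : R) :
  (s%:P - r *: 'X^2).[t] + ('X^2 - 1).[t] * x = s - x + t ^+ 2 * (x - r).
Proof.
rewrite !(hornerD, hornerN, hornerZ, hornerXn, hornerC); ring.
Qed.

Let num_bound (t : R) : 0 <= t <= 1 -> `|('X^2 - 1).[t]| <= 1.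
Proof.
move=> t01; rewrite !(hornerD, hornerN, hornerXn, hornerC) ler_norml.
by apply/andP; split; nra.
Qed.

Let den_ge (r s m t x : R) : 0 <= t <= 1 -> m <= s - x -> m <= s - r ->
  m <= s - x + t ^+ 2 * (x - r).
Proof.
move=> /andP[t0 t1] h1 h2.
have q1 : 0 <= 1 - t ^+ 2 by rewrite subr_ge0 exprn_ile1.
have := mulr_ge0 q1 (_ : 0 <= s - x - m); have := mulr_ge0 (sqr_ge0 t) (_ : 0 <= s - r - m).
rewrite !subr_ge0 => /(_ h2) H1 /(_ h1) H2; lra.
Qed.

(** Under the integral the left-hand side is the [t]-derivative of
    [(s - r) t / (s - x + t^2 (x - r))], which goes from [0] to [1]. This works on both sides of [r]
    and at [r] itself. *)
Lemma gauge_left_ode (r s x : R) : x < s -> r < s ->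
  2 * ((x - r) * (s - x)) * (- gauge_left r s 1 x)
  + (r + s - 2 * x) * gauge_left r s 0 x = 1.
Proof.
move=> xs rs; pose m := Num.min (s - x) (s - r).
have m0 : 0 < m by rewrite lt_min !subr_gt0 xs rs.
have D (t : R) : 0 <= t <= 1 -> 0 < s - x + t ^+ 2 * (x - r).
  move=> t01; apply: (lt_le_trans m0); apply: den_ge => //.
  - by rewrite ge_min lexx.
  - by rewrite ge_min lexx orbT.
have Dm (t : R) : 0 <= t <= 1 -> m <= (s%:P - r *: 'X^2).[t] + ('X^2 - 1).[t] * x.
  move=> t01; rewrite horner_den; apply: den_ge => //.
  - by rewrite ge_min lexx.
  - by rewrite ge_min lexx orbT.
have i0 := affine_kernel_integrable m0 0 Dm.
have i1 := affine_kernel_integrable m0 1 Dm.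
have ic (c : R) k : mu.-integrable `[0, 1] (EFin \o (fun t : R => c *
    (('X^2 - 1).[t] ^+ k / ((s%:P - r *: 'X^2).[t] + ('X^2 - 1).[t] * x) ^+ k.+1))).
  apply: continuous_compact_integrable; first exact: segment_compact.
  apply: derivable_within_continuous => t; rewrite in_itv => /Dm/(lt_le_trans m0) D0.
  by derivable_tac; rewrite expf_neq0// gt_eqF.
rewrite mulrN -mulNr.
rewrite /gauge_left /affine_kernel -!RintegralZl//.
rewrite -RintegralD//; [|exact: ic..].
have num1 t : ('X^2 - 1).[t] = t ^+ 2 - 1 :> R.
  by rewrite !(hornerD, hornerN, hornerXn, hornerC).
pose F (t : R) := (s - r) * t / (s - x + t ^+ 2 * (x - r)).
pose g (t : R) := (s - r) * (s - x - t ^+ 2 * (x - r)) / (s - x + t ^+ 2 * (x - r)) ^+ 2.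
transitivity (\int[mu]_(t in `[0, 1]) g t).
  apply: eq_Rintegral => t; rewrite inE/= in_itv/= => t01.
  rewrite horner_den num1 /g; have D1 := D t t01.
  by field; rewrite gt_eqF.
have cg : {within `[0, 1], continuous g}.
  apply: derivable_within_continuous => t; rewrite in_itv => t01.
  have D1 := D t t01; rewrite /g; derivable_tac.
  by rewrite expf_neq0// gt_eqF.
have cF : {within `[0, 1], continuous F}.
  apply: derivable_within_continuous => t; rewrite in_itv => t01.
  have D1 := D t t01; rewrite /F; derivable_tac.
  by rewrite gt_eqF.
have dF (t : R) : 0 < t < 1 -> is_derive t 1 F (g t).
  move=> /andP[t0 t1].
  have D1 : 0 < s - x + t ^+ 2 * (x - r) by apply: D; rewrite !ltW.
  rewrite /F /g; is_derive_tac; first by rewrite gt_eqF.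
  by field; rewrite gt_eqF.
rewrite (Rintegral_FTC2 ltr01 cg cF dF).
have -> : F 1 = 1.
  rewrite /F (_ : s - x + _ = s - r); last ring.
  by rewrite mulr1 divff// gt_eqF ?subr_gt0.
by rewrite /F mulr0 mul0r subr0.
Qed.

(** With [u = sqrt (x - r)] and [v = sqrt (s - x)] the integrals are [atan (u / v) / (u v)] and
    [atan (v / u) / (u v)]. The solution smooth at [s] is minus the reflected one, so this sum is
    the difference of the two solutions. *)
Lemma gauge_left_sum (r s x : R) : r < x < s ->
  gauge_left r s 0 x + gauge_left (- s) (- r) 0 (- x) =
  pi / (2 * Num.sqrt ((x - r) * (s - x))).
Proof.
have h (r' s' y : R) : r' < y < s' ->
    gauge_left r' s' 0 y = atan (Num.sqrt (y - r') / Num.sqrt (s' - y)) /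
      (Num.sqrt (y - r') * Num.sqrt (s' - y)).
  move=> /andP[ry ys].
  set u := Num.sqrt (y - r'); set v := Num.sqrt (s' - y).
  have u0 : 0 < u by rewrite sqrtr_gt0 subr_gt0.
  have v0 : 0 < v by rewrite sqrtr_gt0 subr_gt0.
  have u2 : u ^+ 2 = y - r' by rewrite sqr_sqrtr// subr_ge0 ltW.
  have v2 : v ^+ 2 = s' - y by rewrite sqr_sqrtr// subr_ge0 ltW.
  pose F (t : R) := atan (u / v * t) / (u * v).
  pose g (t : R) := (v ^+ 2 + t ^+ 2 * u ^+ 2)^-1.
  have D (t : R) : 0 < v ^+ 2 + t ^+ 2 * u ^+ 2.
    by rewrite ltr_pwDl ?exprn_gt0// mulr_ge0 ?sqr_ge0.
  have -> : gauge_left r' s' 0 y = \int[mu]_(t in `[0, 1]) g t.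
    apply: eq_Rintegral => t _; rewrite horner_den expr0 expr1 mul1r /g.
    by rewrite u2 v2.
  have cg : {within `[0, 1], continuous g}.
    apply: derivable_within_continuous => t _; rewrite /g; derivable_tac.
    by rewrite gt_eqF.
  have dF (t : R) : 0 < t < 1 -> is_derive t 1 F (g t).
    move=> _; rewrite /F /g; is_derive_tac; field.
    have D1 := D t; rewrite !gt_eqF//=.
    by rewrite (_ : _ + _ = v ^+ 2 + t ^+ 2 * u ^+ 2)//; ring.
  have cF : {within `[0, 1], continuous F}.
    apply: derivable_within_continuous => t _; rewrite /F; derivable_tac.
  rewrite (Rintegral_FTC2 ltr01 cg cF dF) /F.
  by rewrite mulr0 atan0 mul0r subr0 mulr1.
move=> /andP[rx xs]; rewrite h ?rx//.
rewrite h ?ltrN2 ?xs// !opprK (addrC (- x)) (addrC (- r)).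
have x0 : 0 < x - r by rewrite subr_gt0.
have s0 : 0 < s - x by rewrite subr_gt0.
rewrite sqrtrM ?(ltW x0)//.
set u := Num.sqrt (x - r); set v := Num.sqrt (s - x).
have u0 : 0 < u by rewrite sqrtr_gt0.
have v0 : 0 < v by rewrite sqrtr_gt0.
(* The sum has zero derivative on the positive half-line and equals [pi / 2] at [1]. *)
have atanV (k : R) : 0 < k -> atan k + atan k^-1 = pi / 2.
  move=> k0; pose G (t : R) := atan t + atan t^-1.
  have mk : 0 < Num.min 1 k by rewrite lt_min ltr01.
  have : `|G k - G 1| <= 0 * `|k - 1|.
    apply: (@is_derive_lipschitz R G (fun=> 0)) => t /andP[t1 _].
      have t0 := lt_le_trans mk t1.
      rewrite /G; is_derive_tac; first by rewrite gt_eqF.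
      have : 0 < 1 + t ^+ 2 by rewrite ltr_pwDl// sqr_ge0.
      move=> t2; field; rewrite !gt_eqF//=.
      by rewrite addrC.
    by rewrite normr0.
  rewrite mul0r normr_le0 subr_eq0 => /eqP; rewrite /G invr1 atan1 => ->.
  by field.
have : atan (u / v) + atan (v / u) = pi / 2.
  by rewrite -(atanV (u / v)) ?divr_gt0// invf_div.
move=> e; have -> : pi = 2 * (atan (u / v) + atan (v / u)) by rewrite e; field.
by field; rewrite !gt_eqF.
Qed.

(* [96 / m ^+ 4 = 3! (2 / m) ^+ 4]: the denominators are at least [m / 2] on a
   neighbourhood of [x], which is needed to differentiate under the integral. *)
Lemma gauge_left_gauge (r s m hi lo : R) : 0 < m -> m <= 1 -> m <= s - hi -> m <= s - r ->
  gauge r s (96 / m ^+ 4) lo hi (gauge_left r s 0)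
    (fun x => - gauge_left r s 1 x) (fun x => 2 * gauge_left r s 2 x)
    (fun x => - (6 * gauge_left r s 3 x)).
Proof.
move=> m0 m1 mhi msr x /andP[_ xhi].
have m20 : 0 < m / 2 by lra.
have xv : x - 1 < x < x + m / 2 by lra.
have den (t y : R) : 0 <= t <= 1 -> x - 1 < y < x + m / 2 ->
    m / 2 <= (s%:P - r *: 'X^2).[t] + ('X^2 - 1).[t] * y.
  by move=> t01 /andP[_ ym]; rewrite horner_den; apply: den_ge => //; lra.
have d k := is_derive_affine_kernel m20 num_bound k xv den.
have b (k : nat) (c : R) : (k <= 3)%N -> 0 <= c <= 6 -> `|c * gauge_left r s k x| <= 96 / m ^+ 4.
  move=> k3 /andP[c0 c6].
  have bk : `|gauge_left r s k x| <= ((m / 2)^-1) ^+ k.+1.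
    by apply: affine_kernel_bound => // t t01; exact: den.
  have m21 : 1 <= (m / 2)^-1 by rewrite invf_ge1//; lra.
  have : ((m / 2)^-1) ^+ k.+1 <= ((m / 2)^-1) ^+ 4 by apply: ler_weXn2l.
  rewrite normrM (ger0_norm c0) => h2.
  apply: (@le_trans _ _ (6 * ((m / 2)^-1) ^+ 4)).
    by apply: ler_pM => //; apply: le_trans bk h2.
  by rewrite le_eqVlt; apply/orP; left; apply/eqP; field; rewrite gt_eqF.
split.
- by apply: is_derive_val (d 0%N) _; rewrite mulN1r.
- by apply: is_derive_val (is_derive_opp (d 1%N)) _; rewrite mulNr opprK.
- apply: is_derive_val (is_derive_mul (is_derive_const 2 _) (d 2%N)) _.
  by rewrite /gauge_left; ring.
- split.
  + by rewrite -[X in `|X|]mul1r b//; lra.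
  + by rewrite normrN -[X in `|X|]mul1r b//; lra.
  + by rewrite b//; lra.
  + by rewrite normrN b//; lra.
- by apply: gauge_left_ode; lra.
Qed.

End Gauge.

(** * The energy in the bulk *)

(* Here [u] and [v] stand for [psi eta] and [psi^2], which are [O(E / k)] and
   [O(E / k^2)], [m] for the mass of [psi^2] on [-1, x], and [a0 a1 a2], [- b0],
   [b1], [- b2] for the values at [x] of the two gauge functions and of their
   first two derivatives. *)
Lemma energy_balance (R : realType) (k p0 M x m E u v a0 a1 a2 b0 b1 b2 sP : R) :
  1 <= k -> 0 < p0 -> 0 < M -> 8 * M <= k * p0 ->
  `|x| <= 1 -> 0 < 1 - x ^+ 2 -> 1 - x ^+ 2 <= 1 -> 0 <= v ->
  p0 * k ^+ 2 * v <= E -> p0 * k * `|u| <= E / 2 ->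
  `|a0 * E - (1 - x ^+ 2) * a1 * u
    + ((1 - x ^+ 2) ^+ 2 * a2 - 2 * x * (1 - x ^+ 2) * a1) / 2 * v - k ^+ 2 * m|
    <= 10 * M * k * m ->
  `|- (- b0 * E - (1 - x ^+ 2) * b1 * u
    + ((1 - x ^+ 2) ^+ 2 * - b2 - 2 * x * (1 - x ^+ 2) * b1) / 2 * v)
    - k ^+ 2 * (1 - m)| <= 10 * M * k * (1 - m) ->
  `|a1| <= M -> `|a2| <= M -> `|b1| <= M -> `|b2| <= M ->
  a0 + b0 = pi / (2 * sP) -> 0 < sP -> sP <= 1 ->
  `|E - 2 * k ^+ 2 * sP / pi| <= (10 * M + (8 * M + 80 * M ^+ 2) / p0) * k /\
  E <= (2 + 20 * M) * k ^+ 2.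
Proof.
move=> k1 p00 M0 kM ax X X1 v0 e1 e2 iL iR bL1 bL2 bR1 bR2 GS sP0 sP1.
have k0 : 0 < k by exact: lt_le_trans ltr01 k1.
have E0 : 0 <= E.
  apply: le_trans e1; apply: mulr_ge0 => //; apply: mulr_ge0; [exact: ltW p00|exact: sqr_ge0].
pose q := E / (p0 * k).
have pk0 : 0 < p0 * k by exact: mulr_gt0.
have q0 : 0 <= q by rewrite divr_ge0// ltW.
have uq : `|u| <= q / 2.
  by rewrite /q mulrAC ler_pdivlMr// mulrC.
have vq : v <= q.
  rewrite /q ler_pdivlMr//; apply: le_trans e1; rewrite mulrC ler_wpM2r//.
  by rewrite ler_wpM2l ?(ltW p00)// expr2 ler_peMr// ltW.
have Mq : 8 * M * q <= E.
  by rewrite /q mulrA ler_pdivrMr// mulrC ler_wpM2l//; lra.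
have Mq' : q * k = E / p0.
  by rewrite /q; field; rewrite !gt_eqF.
clearbody q.
have bd (f g : R) C D : `|f| <= C -> `|g| <= D -> `|f * g| <= C * D.
  by move=> fC gD; rewrite normrM ler_pM.
have nX : `|1 - x ^+ 2| <= 1 by rewrite ger0_norm// ltW.
have T1 : `|(1 - x ^+ 2) * (a1 + - b1)| <= 1 * (2 * M).
  by apply: bd => //; apply: (le_trans (ler_normD _ _)); rewrite normrN; lra.
have T2 : `|(1 - x ^+ 2) ^+ 2 * (a2 + b2)| <= 1 * (2 * M).
  apply: bd; first by rewrite normrX exprn_ile1.
  by apply: (le_trans (ler_normD _ _)); lra.
have T3 : `|x * ((1 - x ^+ 2) * (a1 + - b1))| <= 1 * (1 * (2 * M)) by exact: bd.
have t1 := bd _ _ _ _ T1 uq.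
have nv : `|v| <= q by rewrite ger0_norm.
have t2 := bd _ _ _ _ T2 nv.
have t3 := bd _ _ _ _ T3 nv.
(* The two increments are added: the masses [m] and [1 - m] sum to [1], and the terms in [u] and [v]
   cost [(1 + 1 + 2) M q]. *)
have SE : `|(a0 + b0) * E - k ^+ 2| <= 10 * M * k + 4 * M * q.
  move: iL iR t1 t2 t3; rewrite !ler_norml.
  move=> /andP[? ?] /andP[? ?] /andP[? ?] /andP[? ?] /andP[? ?].
  by apply/andP; split; lra.
have pi2 := @pihalf_ge1 R; have pi0 := @pi_gt0 R.
set c := (pi : R) in pi2 pi0 GS *; clearbody c.
have S1 : 1 <= a0 + b0.
  by rewrite GS invfM mulrA -[leLHS]mulr1 ler_pM// invf_ge1.
(* By [8 * M * q <= E] the error [4 * M * q] is absorbed by half of [E]. *)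
have Ek : E <= (2 + 20 * M) * k ^+ 2.
  have SE1 : E <= (a0 + b0) * E by rewrite ler_peMl.
  have kk : M * k <= M * k ^+ 2 by rewrite ler_wpM2l ?(ltW M0)// expr2 ler_peMl// ltW.
  by move: SE; rewrite ler_norml => /andP[_ ?]; lra.
split => //.
have qb : 4 * M * q <= (8 * M + 80 * M ^+ 2) / p0 * k.
  rewrite -(ler_pM2r k0) (_ : 4 * M * q * k = 4 * M * E / p0); last first.
    by rewrite -!mulrA Mq'.
  rewrite [leRHS](_ : _ = 4 * M * ((2 + 20 * M) * k ^+ 2) / p0); last first.
    by field; rewrite gt_eqF.
  by rewrite ler_wpM2r ?invr_ge0 ?(ltW p00)// ler_wpM2l// mulr_ge0// ltW.
have -> : 2 * k ^+ 2 * sP / c = k ^+ 2 / (a0 + b0).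
  by rewrite GS; field; rewrite !gt_eqF.
have S0 : 0 < a0 + b0 by exact: lt_le_trans S1.
have -> : E - k ^+ 2 / (a0 + b0) = ((a0 + b0) * E - k ^+ 2) / (a0 + b0).
  by field; rewrite gt_eqF.
rewrite normrM normfV (gtr0_norm S0) ler_pdivrMr//.
apply: (le_trans SE); apply: (@le_trans _ _ (10 * M * k + (8 * M + 80 * M ^+ 2) / p0 * k)).
  by rewrite lerD2l.
rewrite -mulrDl ler_peMr//; apply: mulr_ge0; last exact: ltW.
apply: addr_ge0; first by rewrite mulr_ge0// ltW.
apply: divr_ge0; last exact: ltW.
apply: addr_ge0; first by rewrite mulr_ge0// ltW.
by rewrite mulr_ge0// sqr_ge0.
Qed.

(** * The energy identity, integrated from both endpoints *)

Section Amplitude.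
Variable R : realType.

Lemma is_derive_ge0_le (f df : R -> R) (c d : R) : c <= d ->
  {within `[c, d], continuous f} ->
  (forall x, c < x < d -> is_derive x 1 f (df x)) ->
  (forall x, c < x < d -> 0 <= df x) -> f c <= f d.
Proof.
rewrite le_eqVlt => /predU1P[->//|cd] cf dF d0.
have dF' x : x \in `]c, d[ -> is_derive x 1 f (df x) by rewrite in_itv => /dF.
have [e] := MVT cd dF' cf; rewrite in_itv => /d0 e0 fe.
by rewrite -subr_ge0 fe mulr_ge0// subr_ge0 ltW.
Qed.

Variables (k r s : R) (l w y z J : R -> R).
Hypothesis k1 : 1 <= k.
Let P x := (x - r) * (s - x).
Let V x := k ^+ 2 * P x + k * (1 - x ^+ 2).
Hypothesis w_ge0 : forall x, 0 <= w x.
Hypothesis cw : {within `[-1, 1], continuous w}.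
Hypothesis dw : forall x : R, -1 < x < 1 -> is_derive x 1 w (w x * l x / (1 - x ^+ 2)).
Hypothesis dy : forall x : R, -1 < x < 1 ->
  is_derive x 1 y ((z x - l x / 2 * y x) / (1 - x ^+ 2)).
Hypothesis dz : forall x : R, -1 < x < 1 ->
  is_derive x 1 z (- (V x * y x + l x / 2 * z x) / (1 - x ^+ 2)).
Hypothesis cy : forall x : R, derivable y x 1.
Hypothesis cz : forall x : R, derivable z x 1.
Hypothesis zl : z (-1) = l (-1) / 2 * y (-1).
Hypothesis zr : z 1 = l 1 / 2 * y 1.
Hypothesis Pl : k ^+ 2 * P (-1) = - (l (-1) ^+ 2 / 4).
Hypothesis Pr : k ^+ 2 * P 1 = - (l 1 ^+ 2 / 4).
Hypothesis cJ : {within `[-1, 1], continuous J}.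
Hypothesis dJ : forall x : R, -1 < x < 1 -> is_derive x 1 J (y x ^+ 2 * w x).

(** With [psi = sqrt w y] and [eta = sqrt w z] this is [eta^2 + V psi^2]. Splitting off [w] leaves
    [y] and [z] differentiable up to the endpoints; they are polynomials in the application. *)
Definition energy x := w x * (z x ^+ 2 + V x * y x ^+ 2).

(** This is [G E - dG psi eta + ddG psi^2 / 2] with [d = (1 - x^2) d/dx] written out. *)
Definition bracket (G0 G1 G2 : R -> R) x :=
  w x * (G0 x * (z x ^+ 2 + V x * y x ^+ 2) - (1 - x ^+ 2) * G1 x * (y x * z x)
    + ((1 - x ^+ 2) ^+ 2 * G2 x - 2 * x * (1 - x ^+ 2) * G1 x) / 2 * y x ^+ 2).

(** The factor [1 - x^2] vanishes at the endpoint, where moreover [z = l y / 2] and [V = - l^2 / 4],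
    so that [z^2 + V y^2 = 0]. *)
Lemma bracket_left G0 G1 G2 : bracket G0 G1 G2 (-1) = 0.
Proof.
rewrite /bracket /V Pl zl (_ : 1 - (-1) ^+ 2 = 0 :> R); last ring.
by field.
Qed.

Lemma bracket_right G0 G1 G2 : bracket G0 G1 G2 1 = 0.
Proof.
rewrite /bracket /V Pr zr (_ : 1 - 1 ^+ 2 = 0 :> R); last ring.
by field.
Qed.

Lemma one_sub_sqr_gt0 (x : R) : -1 < x < 1 -> 0 < 1 - x ^+ 2.
Proof. by move=> /andP[? ?]; nra. Qed.

Lemma is_derive_bracket M lo hi G0 G1 G2 G3 (x : R) :
  gauge r s M lo hi G0 G1 G2 G3 -> lo <= x <= hi -> -1 < x < 1 ->
  is_derive x 1 (bracket G0 G1 G2)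
   ((k ^+ 2 + k * (2 * (1 - x ^+ 2) * G1 x - 2 * x * G0 x)
    + ((1 - x ^+ 2) ^+ 2 * G3 x - 6 * x * (1 - x ^+ 2) * G2 x
       - (2 - 6 * x ^+ 2) * G1 x) / 2) * (y x ^+ 2 * w x)).
Proof.
move=> /[apply] -[d0 d1 d2 _ e] x1.
have dwx := dw x1; have dyx := dy x1; have dzx := dz x1.
have X0 : 1 - x ^+ 2 != 0 by rewrite gt_eqF// one_sub_sqr_gt0.
rewrite /bracket /V /P; is_derive_tac.
(* The gauge equation enters here: it turns [k^2 (2 P G' + P' G)] into [k^2]. *)
have ek : k ^+ 2 = k ^+ 2 * (2 * ((x - r) * (s - x)) * G1 x + (r + s - 2 * x) * G0 x).
  by rewrite e mulr1.
by rewrite [in RHS]ek /V /P; field.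
Qed.

Lemma within_continuous_bracket M c d G0 G1 G2 G3 :
  gauge r s M c d G0 G1 G2 G3 -> -1 <= c -> d <= 1 ->
  {within `[c, d], continuous (bracket G0 G1 G2)}.
Proof.
move=> g c1 d1; have cd : `[c, d] `<=` `[-1, 1].
  by move=> x /=; rewrite !in_itv/= => /andP[? ?]; apply/andP; split; lra.
pose h x := G0 x * (z x ^+ 2 + V x * y x ^+ 2) - (1 - x ^+ 2) * G1 x * (y x * z x)
    + ((1 - x ^+ 2) ^+ 2 * G2 x - 2 * x * (1 - x ^+ 2) * G1 x) / 2 * y x ^+ 2.
have ch : {within `[c, d], continuous h}.
  apply: derivable_within_continuous => x; rewrite in_itv => /g[d0' d1' d2' _ _].
  have dyx : is_derive x 1 y ('D_1 y x) by apply: derivableP; exact: cy.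
  have dzx : is_derive x 1 z ('D_1 z x) by apply: derivableP; exact: cz.
  by rewrite /h /V /P; derivable_tac.
move=> x; apply: cvgM; first exact: (continuous_subspaceW cd).
exact: ch.
Qed.

(** The derivatives of the bracket and of [k^2 J] differ by at most [10 M k J']. The error is thus
    measured by the mass of [psi^2], which keeps it finite up to the endpoints. *)
Lemma bracket_increment M c d G0 G1 G2 G3 :
  gauge r s M c d G0 G1 G2 G3 -> -1 <= c -> c <= d -> d <= 1 ->
  `|bracket G0 G1 G2 d - bracket G0 G1 G2 c - k ^+ 2 * (J d - J c)|
    <= 10 * M * k * (J d - J c).
Proof.
move=> g c1 cd d1; have cB := within_continuous_bracket g c1 d1.
have cJ' : {within `[c, d], continuous J}.
  apply: continuous_subspaceW cJ.
  by move=> x /=; rewrite !in_itv/= => /andP[? ?]; apply/andP; split; lra.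
pose th x := k ^+ 2 + k * (2 * (1 - x ^+ 2) * G1 x - 2 * x * G0 x)
    + ((1 - x ^+ 2) ^+ 2 * G3 x - 6 * x * (1 - x ^+ 2) * G2 x
       - (2 - 6 * x ^+ 2) * G1 x) / 2.
(* The term in [k] gives [(2 + 2) M k] and the rest [(1 + 6 + 4) M / 2], at most [10 M k] together
   as [k >= 1]. *)
have thb x : c < x < d -> `|th x - k ^+ 2| <= 10 * M * k.
  move=> /andP[cx xd]; have [|_ _ _ [b0 b1 b2 b3] _] := g x; first by rewrite !ltW.
  have M0 : 0 <= M := le_trans (normr_ge0 _) b0.
  have x1 : -1 < x < 1 by apply/andP; split; lra.
  have X := one_sub_sqr_gt0 x1.
  have X1 : 1 - x ^+ 2 <= 1 by rewrite lerBlDr lerDl sqr_ge0.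
  have ax : `|x| <= 1 by rewrite ler_norml; lra.
  have bd (u v : R) C : `|u| <= C -> 0 <= C -> `|v| <= M -> `|u * v| <= C * M.
    by move=> uC C0 vM; rewrite normrM ler_pM.
  have e1 : `|2 * (1 - x ^+ 2) * G1 x| <= 2 * M.
    by apply: bd => //; rewrite ger0_norm; lra.
  have e2 : `|2 * x * G0 x| <= 2 * M.
    by apply: bd => //; rewrite normrM ger0_norm//; lra.
  have e3 : `|(1 - x ^+ 2) ^+ 2 * G3 x| <= 1 * M.
    by apply: bd => //; rewrite normrX ger0_norm ?expr_le1 ?(ltW X).
  have e4 : `|6 * x * (1 - x ^+ 2) * G2 x| <= 6 * M.
    apply: bd => //; rewrite normrM normrM (ger0_norm (ltW X)) ger0_norm//.
    by have := ler_pM (normr_ge0 x) (ltW X) ax X1; nra.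
  have e5 : `|(2 - 6 * x ^+ 2) * G1 x| <= 4 * M.
    by apply: bd => //; rewrite ler_norml; have := sqr_ge0 x; nra.
  rewrite /th; move: e1 e2 e3 e4 e5.
  move: (2 * (1 - x ^+ 2) * G1 x) (2 * x * G0 x) ((1 - x ^+ 2) ^+ 2 * G3 x)
    (6 * x * (1 - x ^+ 2) * G2 x) ((2 - 6 * x ^+ 2) * G1 x) => A1 A2 A3 A4 A5.
  rewrite !ler_norml => /andP[? ?] /andP[? ?] /andP[? ?] /andP[? ?] /andP[? ?].
  have k0 : 0 <= k by exact: le_trans ler01 k1.
  have q1 : 0 <= k * (A1 - A2 + 4 * M) by apply: mulr_ge0 => //; lra.
  have q2 : 0 <= k * (4 * M - (A1 - A2)) by apply: mulr_ge0 => //; lra.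
  have q3 : 0 <= M * (k - 1) by rewrite mulr_ge0// subr_ge0.
  by apply/andP; split; lra.
have mono (e : R) (sg : R) : (forall x, c < x < d -> 0 <= sg * (th x - k ^+ 2) + e) ->
    sg * (bracket G0 G1 G2 c - k ^+ 2 * J c) + e * J c <=
    sg * (bracket G0 G1 G2 d - k ^+ 2 * J d) + e * J d.
  move=> pos.
  apply: (@is_derive_ge0_le (fun x => sg * (bracket G0 G1 G2 x - k ^+ 2 * J x) + e * J x)
    (fun x => (sg * (th x - k ^+ 2) + e) * (y x ^+ 2 * w x))) => //.
  - move=> x; apply: cvgD; last by apply: cvgM; [exact: cvg_cst|exact: cJ'].
    apply: cvgM; first exact: cvg_cst.
    apply: cvgB; first exact: cB.
    by apply: cvgM; [exact: cvg_cst|exact: cJ'].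
  - move=> x /andP[cx xd]; have x1 : -1 < x < 1 by apply/andP; split; lra.
    have cxd : c <= x <= d by rewrite !ltW.
    have dB := is_derive_bracket g cxd x1.
    have dJx := dJ x1.
    by is_derive_tac; rewrite /th; ring.
  - by move=> x cxd; rewrite mulr_ge0 ?pos// mulr_ge0 ?sqr_ge0.
have /mono m1 x : c < x < d -> 0 <= 1 * (th x - k ^+ 2) + 10 * M * k.
  by move=> /thb; rewrite ler_norml => /andP[? ?]; lra.
have /mono m2 x : c < x < d -> 0 <= - 1 * (th x - k ^+ 2) + 10 * M * k.
  by move=> /thb; rewrite ler_norml => /andP[? ?]; lra.
by rewrite ler_norml; apply/andP; split; lra.
Qed.

Hypothesis rs : r < s.
Hypothesis rm1 : -1 <= r.
Hypothesis s1 : s <= 1.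
Hypothesis P_le : forall x, 0 < P x -> P x <= 1 - x ^+ 2.
Hypothesis J_left : J (-1) = 0.
Hypothesis J_right : J 1 = 1.

Lemma P_gt0_between (x : R) : 0 < P x -> r < x < s.
Proof.
rewrite /P => Px; apply/andP; split; rewrite ltNge; apply/negP => h.
  by have := mulr_ge0 (_ : 0 <= r - x) (_ : 0 <= s - x); rewrite !subr_ge0 => /(_ h);
    move=> /(_ (ltW (le_lt_trans h rs))); nra.
by have := mulr_ge0 (_ : 0 <= x - r) (_ : 0 <= x - s); rewrite !subr_ge0 => H;
  have := H (ltW (lt_le_trans rs h)) h; nra.
Qed.

Lemma P_gt0_itv (x : R) : 0 < P x -> -1 < x < 1.
Proof.
by move=> /P_gt0_between /andP[rx xs]; rewrite (le_lt_trans rm1 rx) (lt_le_trans xs s1).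
Qed.

(** The constant of [gauge_left_gauge] at [m = p0 / 2]: where [P x >= p0], both turning points are
    at distance at least [p0 / 2] from [x]. *)
Definition gauge_bound (p0 : R) : R := 96 / (p0 / 2) ^+ 4.

(** Both follow from [V >= p0 k^2]; the second is the arithmetic-geometric mean inequality, with
    [(p0 k)^2 <= p0 k^2] because [p0 <= 1]. *)
Lemma energy_psi (p0 x : R) : 0 < p0 -> p0 <= P x ->
  p0 * k ^+ 2 * (w x * y x ^+ 2) <= energy x /\
  p0 * k * `|w x * (y x * z x)| <= energy x / 2.
Proof.
move=> p00 Px; have P0 := lt_le_trans p00 Px; have x1 := P_gt0_itv P0.
have X := one_sub_sqr_gt0 x1; have w0 := w_ge0 x.
have p01 : p0 <= 1.
  by apply: (le_trans Px); apply: (le_trans (P_le P0)); rewrite lerBlDr lerDl sqr_ge0.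
have k0 : 0 <= k by exact: le_trans ler01 k1.
have VP : p0 * k ^+ 2 <= V x.
  rewrite /V mulrC; apply: (@le_trans _ _ (k ^+ 2 * P x)).
    by rewrite ler_wpM2l// sqr_ge0.
  by rewrite lerDl mulr_ge0// ltW.
have y2 := sqr_ge0 (y x); have z2 := sqr_ge0 (z x).
have Vy := ler_wpM2r y2 VP.
rewrite /energy; split.
  by rewrite (mulrCA _ (w x)) ler_wpM2l//; lra.
rewrite normrM (ger0_norm w0) mulrCA -mulrA ler_wpM2l//.
have q : (p0 * k) ^+ 2 * y x ^+ 2 <= V x * y x ^+ 2.
  apply: le_trans Vy; rewrite ler_wpM2r// exprMn ler_wpM2r ?sqr_ge0//.
  by rewrite expr2 ler_piMl// ltW.
have := sqr_ge0 (`|z x| - p0 * k * `|y x|).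
have -> : (`|z x| - p0 * k * `|y x|) ^+ 2 =
  `|z x| ^+ 2 + (p0 * k) ^+ 2 * `|y x| ^+ 2 - 2 * (p0 * k * (`|y x| * `|z x|)) by ring.
by rewrite !real_normK ?num_real// normrM; lra.
Qed.

Lemma bracketE G0 G1 G2 x : bracket G0 G1 G2 x =
  G0 x * energy x - (1 - x ^+ 2) * G1 x * (w x * (y x * z x))
  + ((1 - x ^+ 2) ^+ 2 * G2 x - 2 * x * (1 - x ^+ 2) * G1 x) / 2 * (w x * y x ^+ 2).
Proof. by rewrite /bracket /energy; ring. Qed.

Lemma energy_asymptotics (p0 x : R) : 0 < p0 -> p0 <= P x ->
  8 * gauge_bound p0 <= k * p0 ->
  `|energy x - 2 * k ^+ 2 * Num.sqrt (P x) / pi| <=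
    (10 * gauge_bound p0 + (8 * gauge_bound p0 + 80 * gauge_bound p0 ^+ 2) / p0) * k /\
  energy x <= (2 + 20 * gauge_bound p0) * k ^+ 2.
Proof.
set M := gauge_bound p0 => p00 Px kM.
have P0 := lt_le_trans p00 Px; have x1 := P_gt0_itv P0; have rxs := P_gt0_between P0.
have rm1' := rm1; have s1' := s1.
have X := one_sub_sqr_gt0 x1.
have k0 : 0 < k by exact: lt_le_trans ltr01 k1.
have X1 : 1 - x ^+ 2 <= 1 by rewrite lerBlDr lerDl sqr_ge0.
have P1 : P x <= 1 by exact: le_trans (P_le P0) X1.
have p01 : p0 <= 1 by exact: le_trans P1.
have [xm1 x1'] := andP x1; have [rx xs] := andP rxs.
have m0 : 0 < p0 / 2 by lra.
have m1 : p0 / 2 <= 1 by lra.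
have mL : p0 / 2 <= s - x.
  have : P x <= 2 * (s - x) by rewrite /P ler_wpM2r ?subr_ge0 ?ltW//; lra.
  by lra.
have mR : p0 / 2 <= x - r.
  have : P x <= (x - r) * 2 by rewrite /P ler_wpM2l ?subr_ge0 ?ltW//; lra.
  by lra.
have M0 : 0 < M by rewrite /M /gauge_bound divr_gt0// exprn_gt0.
have mS : p0 / 2 <= s - r by lra.
have gL := @gauge_left_gauge R r s (p0 / 2) x (-1) m0 m1 mL mS.
have mR' : p0 / 2 <= - r - - x by lra.
have mS' : p0 / 2 <= - r - - s by lra.
(* The solution on [[x, 1]] is built on [[-1, - x]] for the turning points [- s] and [- r], then
   reflected. *)
have gR := @gauge_left_gauge R (- s) (- r) (p0 / 2) (- x) (- 1) m0 m1 mR' mS'.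
have {}gR := gauge_reflect gR; rewrite !opprK in gR.
have iL := bracket_increment gL (lexx _) (ltW xm1) (ltW x1').
have iR := bracket_increment gR (ltW xm1) (ltW x1') (lexx _).
rewrite bracket_left J_left !subr0 in iL.
rewrite bracket_right J_right sub0r in iR.
have GS := gauge_left_sum rxs.
have [|_ _ _ [bL0 bL1 bL2 _] _] := gL x; first by rewrite lexx ltW.
have [|_ _ _ [bR0 bR1 bR2 _] _] := gR x; first by rewrite lexx ltW.
have [e1 e2] := energy_psi p00 Px.
move: iL iR bL0 bL1 bL2 bR0 bR1 bR2 GS; rewrite !bracketE.
rewrite -/(gauge_bound p0) -/M -/(P x).
set E := energy x in e1 e2 *; set u := w x * (y x * z x) in e2 *.
set v := w x * y x ^+ 2 in e1 *.
move=> iL iR _ bL1 bL2 _ bR1 bR2 GS.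
have v0 : 0 <= v by rewrite mulr_ge0// sqr_ge0.
have sP0 : 0 < Num.sqrt (P x) by rewrite sqrtr_gt0.
have sP1 : Num.sqrt (P x) <= 1 by rewrite -sqrtr1 ler_wsqrtr.
have ax : `|x| <= 1 by rewrite ler_norml; apply/andP; split; exact: ltW.
rewrite normrN in bR2.
exact: (energy_balance k1 p00 M0 kM ax X X1 v0 e1 e2 iL iR bL1 bL2 bR1 bR2 GS sP0 sP1).
Qed.

End Amplitude.

(** * Solutions on the scale of the mean spacing *)

Lemma itv_one_sub_sqr (R : realType) (t : R) : 0 < 1 - t ^+ 2 -> -1 < t < 1.
Proof. by move=> h; apply/andP; split; nra. Qed.

Section Window.
Variable R : realType.
Variables (k r s p1 T S x delta : R) (psi eta : R -> R).
Hypothesis k1 : 1 <= k.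
Hypothesis rm1 : -1 <= r.
Hypothesis s1 : s <= 1.
Hypothesis rs : r < s.
Let P t := (t - r) * (s - t).
Let V t := k ^+ 2 * P t + k * (1 - t ^+ 2).
Hypothesis p10 : 0 < p1.
Hypothesis P_le : forall t, 0 < P t -> P t <= 1 - t ^+ 2.
Let Ple t : p1 <= P t -> P t <= 1 - t ^+ 2.
Proof. by move=> /(lt_le_trans p10)/P_le. Qed.
Hypothesis dpsi : forall t : R, -1 < t < 1 -> is_derive t 1 psi (eta t / (1 - t ^+ 2)).
Hypothesis deta : forall t : R, -1 < t < 1 ->
  is_derive t 1 eta (- (V t * psi t) / (1 - t ^+ 2)).
Hypothesis delta0 : 0 <= delta.
Hypothesis kdelta : k * delta <= T.
Hypothesis Pwin : forall t, `|t - x| <= delta -> p1 <= P t.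
Hypothesis psiwin : forall t, `|t - x| <= delta -> `|psi t| <= S.
Hypothesis etawin : forall t, `|t - x| <= delta -> `|eta t| <= S * k.

(** The window has radius at most [T / k], and [1 - t^2 >= p1] on it. *)
Lemma inv_one_sub_sqr_lipschitz (t : R) : `|t - x| <= delta ->
  `|(1 - t ^+ 2)^-1 - (1 - x ^+ 2)^-1| <= 2 * T / p1 ^+ 2 / k.
Proof.
move=> tx; have k0 : 0 < k by exact: lt_le_trans ltr01 k1.
have Pt := Pwin tx; have Px : p1 <= P x by apply: Pwin; rewrite subrr normr0.
have Xt := le_trans Pt (Ple Pt); have Xx := le_trans Px (Ple Px).
have X0 : 0 < 1 - t ^+ 2 by exact: lt_le_trans Xt.
have X1 : 0 < 1 - x ^+ 2 by exact: lt_le_trans Xx.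
have -> : (1 - t ^+ 2)^-1 - (1 - x ^+ 2)^-1 =
    (t - x) * (t + x) / ((1 - t ^+ 2) * (1 - x ^+ 2)).
  by field; rewrite !gt_eqF.
have pp : p1 ^+ 2 <= (1 - t ^+ 2) * (1 - x ^+ 2) by rewrite expr2 ler_pM// ltW.
have tx2 : `|t + x| <= 2.
  have /andP[? ?] := itv_one_sub_sqr X0; have /andP[? ?] := itv_one_sub_sqr X1.
  by rewrite ler_norml; apply/andP; split; lra.
rewrite normrM normfV (gtr0_norm (mulr_gt0 X0 X1)) normrM.
rewrite ler_pdivrMr ?mulr_gt0//.
have kt : `|t - x| * k <= T.
  by rewrite mulrC; apply: le_trans kdelta; rewrite ler_wpM2l// ltW.
have T0 : 0 <= T by apply: le_trans kt; rewrite mulr_ge0// ltW.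
apply: (@le_trans _ _ (2 * T / k)).
  rewrite ler_pdivlMr// mulrAC mulrC ler_pM//.
  by rewrite mulr_ge0// ltW.
rewrite [leRHS](_ : _ = 2 * T / k * ((1 - t ^+ 2) * (1 - x ^+ 2) / p1 ^+ 2)); last first.
  by field; rewrite !gt_eqF.
rewrite ler_peMr//; first by rewrite divr_ge0 ?mulr_ge0// ltW.
by rewrite ler_pdivlMr ?mul1r// exprn_gt0.
Qed.

Lemma P_lipschitz (t u : R) : -1 < t < 1 -> -1 < u < 1 -> `|P t - P u| <= 4 * `|t - u|.
Proof.
move=> t1 u1; have -> : P t - P u = (r + s - t - u) * (t - u) by rewrite /P; ring.
rewrite normrM ler_wpM2r//.
have h1 := rm1; have h2 := s1; have h3 := rs; by rewrite ler_norml; apply/andP; split; lra.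
Qed.

Variables (x1 x2 : R).
Hypothesis x1win : `|x1 - x| <= delta.
Hypothesis x2win : `|x2 - x| <= delta.
Let om := k * Num.sqrt (P x).
Let Om := om / (1 - x ^+ 2).
(** [Y] is, up to sign conventions, the Christoffel-Darboux numerator. It satisfies
    [(1 - t^2) Y' = - Z] and [(1 - t^2) Z' = V Y + (1 - t^2) V' psi psi(x1)]. Replacing [V] by
    [om^2] and [1 - t^2] by [1 - x^2] makes [(Z, om Y)] rotate with angle [th]. At [x1], [Y] is zero
    and [Z] is the energy. *)
Let Y t := psi x1 * eta t - eta x1 * psi t.
Let Z t := V t * psi t * psi x1 + eta t * eta x1.
Let th t := Om * (t - x1).
Let bound := S ^+ 2 * (8 + 18 * T / p1 ^+ 2) * k ^+ 2.

Let betw t : Num.min x1 x2 <= t <= Num.max x1 x2 -> `|t - x| <= delta.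
Proof.
move: x1win x2win; rewrite !ler_norml => /andP[? ?] /andP[? ?].
rewrite ge_min le_max => /andP[/orP[?|?] /orP[?|?]]; apply/andP; split; lra.
Qed.

Let in11 t : `|t - x| <= delta -> -1 < t < 1.
Proof.
by move=> /Pwin Pt; apply/itv_one_sub_sqr/(lt_le_trans p10)/(le_trans Pt); exact: Ple.
Qed.

(** [DA] is [V']; [D1] and [D2] are the errors made by freezing the coefficients at [x]. *)
Let DA t := (r + s - 2 * t) * k ^+ 2 - 2 * k * t.
Let D1 t := V t / (1 - t ^+ 2) - om ^+ 2 / (1 - x ^+ 2).
Let D2 t := om * ((1 - t ^+ 2)^-1 - (1 - x ^+ 2)^-1).

Let om2 : om ^+ 2 = k ^+ 2 * P x.
Proof.
have Px : p1 <= P x by apply: Pwin; rewrite subrr normr0.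
by rewrite /om exprMn sqr_sqrtr// ltW// (lt_le_trans p10).
Qed.

(** The pair [(Z, om Y)] rotated back by [th]: the leading terms cancel and only the errors remain
    in the derivative. *)
Let dA t : `|t - x| <= delta ->
  is_derive t 1 (fun t => Z t * cos (th t) - om * Y t * sin (th t))
   (cos (th t) * (DA t * psi t * psi x1 + D1 t * Y t) + sin (th t) * (Z t * D2 t)).
Proof.
move=> /in11 t1; have X := one_sub_sqr_gt0 t1.
have Xx : 0 < 1 - x ^+ 2.
  by apply: one_sub_sqr_gt0; apply: in11; rewrite subrr normr0.
have dp := dpsi t1; have de := deta t1.
rewrite /Z /Y /th /V /P; is_derive_tac.
by rewrite /D1 /D2 /DA /Om /V /P; field; rewrite !gt_eqF.
Qed.

Let dB t : `|t - x| <= delta ->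
  is_derive t 1 (fun t => Z t * sin (th t) + om * Y t * cos (th t))
   (sin (th t) * (DA t * psi t * psi x1 + D1 t * Y t) - cos (th t) * (Z t * D2 t)).
Proof.
move=> /in11 t1; have X := one_sub_sqr_gt0 t1.
have Xx : 0 < 1 - x ^+ 2.
  by apply: one_sub_sqr_gt0; apply: in11; rewrite subrr normr0.
have dp := dpsi t1; have de := deta t1.
rewrite /Z /Y /th /V /P; is_derive_tac.
by rewrite /D1 /D2 /DA /Om /V /P; field; rewrite !gt_eqF.
Qed.

Let norm_bound (a c u v Mu Mv : R) : `|a| <= 1 -> `|c| <= 1 -> `|u| <= Mu -> `|v| <= Mv ->
  `|a * u + c * v| <= Mu + Mv.
Proof.
move=> a1 c1 uM vM; apply: (le_trans (ler_normD _ _)); rewrite !normrM lerD//.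
  by apply: le_trans uM; rewrite ler_piMl.
by apply: le_trans vM; rewrite ler_piMl.
Qed.

Let derivative_bounds t : `|t - x| <= delta ->
  `|DA t * psi t * psi x1 + D1 t * Y t| + `|Z t * D2 t| <= bound.
Proof.
move=> tx; have k0 : 0 < k by exact: lt_le_trans ltr01 k1.
have k1' := k1; have r' := rm1; have s' := s1; have rs' := rs.
have xx : `|x - x| <= delta by rewrite subrr normr0.
have t1 := in11 tx; have x11 := in11 xx.
have X := one_sub_sqr_gt0 t1; have Xx := one_sub_sqr_gt0 x11.
have Pt := Pwin tx; have Px := Pwin xx.
have p1' : p1 <= 1.
  by apply: (le_trans Px); apply: (le_trans (Ple Px)); rewrite lerBlDr lerDl sqr_ge0.
have S0 : 0 <= S := le_trans (normr_ge0 _) (psiwin xx).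
have T0 : 0 <= T by apply: le_trans kdelta; rewrite mulr_ge0// ltW.
have bd (f g : R) C D : `|f| <= C -> `|g| <= D -> `|f * g| <= C * D.
  by move=> fC gD; rewrite normrM ler_pM.
have Vt : `|V t| <= 2 * k ^+ 2.
  have X1 : 1 - t ^+ 2 <= 1 by rewrite lerBlDr lerDl sqr_ge0.
  have Pt1 : P t <= 1 by apply: (le_trans (Ple Pt)).
  have Pt0 : 0 <= P t by apply: le_trans Pt; exact: ltW.
  have kk : k <= k ^+ 2 by rewrite expr2 ler_peMl// ltW.
  rewrite ger0_norm /V; last first.
    apply: addr_ge0; apply: mulr_ge0 => //; rewrite ?sqr_ge0 ?ltW//.
  have a1 : k ^+ 2 * P t <= k ^+ 2 by rewrite ler_piMr// sqr_ge0.
  have a2 : k * (1 - t ^+ 2) <= k by rewrite ler_piMr// ltW.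
  by lra.
have DAt : `|DA t| <= 6 * k ^+ 2.
  have kk : k <= k ^+ 2 by rewrite expr2 ler_peMl// ltW.
  rewrite /DA; have b1 : `|r + s - 2 * t| <= 4 by rewrite ler_norml; apply/andP; split; lra.
  have b2 : `|(r + s - 2 * t) * k ^+ 2| <= 4 * k ^+ 2.
    by apply: bd => //; rewrite ger0_norm// sqr_ge0.
  have b3 : `|2 * k * t| <= 2 * k * 1.
    by apply: bd; [rewrite ger0_norm// mulr_ge0// ltW|rewrite ler_norml; lra].
  by apply: (le_trans (ler_normB _ _)); lra.
have Yt : `|Y t| <= 2 * S ^+ 2 * k.
  rewrite /Y; apply: (le_trans (ler_normB _ _)).
  have b1 := bd _ _ _ _ (psiwin x1win) (etawin tx).
  have b2 := bd _ _ _ _ (etawin x1win) (psiwin tx).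
  by lra.
have Zt : `|Z t| <= 3 * S ^+ 2 * k ^+ 2.
  rewrite /Z; apply: (le_trans (ler_normD _ _)).
  have b1 := bd _ _ _ _ (bd _ _ _ _ Vt (psiwin tx)) (psiwin x1win).
  have b2 := bd _ _ _ _ (etawin tx) (etawin x1win).
  by lra.
have kt : `|t - x| * k <= T.
  by rewrite mulrC; apply: le_trans kdelta; rewrite ler_wpM2l// ltW.
have inv := inv_one_sub_sqr_lipschitz tx.
have D2t : `|D2 t| <= 2 * T / p1 ^+ 2.
  have om_k : `|om| <= k.
    rewrite /om normrM (gtr0_norm k0) ger0_norm ?sqrtr_ge0//.
    rewrite ler_piMr ?(ltW k0)// -sqrtr1 ler_wsqrtr//.
    by apply: (le_trans (Ple Px)); rewrite lerBlDr lerDl sqr_ge0.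
  have := bd _ _ _ _ om_k inv; rewrite -/(D2 t) => h; apply: (le_trans h).
  by rewrite mulrCA divff ?mulr1// gt_eqF.
have q1 : 1 <= (p1 ^+ 2)^-1 by rewrite invf_ge1 ?exprn_gt0// expr_le1// ltW.
have D1t : `|D1 t| <= k * (6 * T / p1 ^+ 2 + 1).
  have -> : D1 t = k ^+ 2 * ((P t - P x) / (1 - t ^+ 2)
       + P x * ((1 - t ^+ 2)^-1 - (1 - x ^+ 2)^-1)) + k.
    by rewrite /D1 om2 /V; field; rewrite !gt_eqF.
  have b1 : `|(P t - P x) / (1 - t ^+ 2)| <= 4 * T / p1 ^+ 2 / k.
    have e1 : `|(1 - t ^+ 2)^-1| <= (p1 ^+ 2)^-1.
      rewrite ger0_norm ?invr_ge0 ?(ltW X)// lef_pV2 ?posrE ?exprn_gt0//.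
      by apply: (@le_trans _ _ p1); [rewrite expr2 ler_piMl// ltW|exact: le_trans (Ple Pt)].
    have e2 : `|P t - P x| <= 4 * T / k.
      apply: (le_trans (P_lipschitz t1 x11)).
      by rewrite -mulrA ler_wpM2l// ler_pdivlMr.
    by have := bd _ _ _ _ e2 e1; rewrite (mulrAC (4 * T)).
  have b2 : `|P x * ((1 - t ^+ 2)^-1 - (1 - x ^+ 2)^-1)| <= 1 * (2 * T / p1 ^+ 2 / k).
    apply: bd => //; rewrite ger0_norm; last by apply: le_trans Px; exact: ltW.
    by apply: (le_trans (Ple Px)); rewrite lerBlDr lerDl sqr_ge0.
  have b3 : `|k ^+ 2 * ((P t - P x) / (1 - t ^+ 2)
       + P x * ((1 - t ^+ 2)^-1 - (1 - x ^+ 2)^-1))| <= k ^+ 2 * (6 * T / p1 ^+ 2 / k).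
    rewrite normrM ger0_norm ?sqr_ge0// ler_wpM2l ?sqr_ge0//.
    by apply: (le_trans (ler_normD _ _)); lra.
  have e : k ^+ 2 * (6 * T / p1 ^+ 2 / k) = k * (6 * T / p1 ^+ 2).
    by field; rewrite !gt_eqF.
  apply: (le_trans (ler_normD _ _)); rewrite (gtr0_norm k0); lra.
(* In units of [S^2 k^2] the three terms are [6], [2 + 12 T / p1^2] and [6 T / p1^2], whose sum is
   the factor in [bound]. *)
have c1 := bd _ _ _ _ (bd _ _ _ _ DAt (psiwin tx)) (psiwin x1win).
have c2 := bd _ _ _ _ D1t Yt.
have c3 := bd _ _ _ _ Zt D2t.
have c4 := ler_normD (DA t * psi t * psi x1) (D1 t * Y t).
rewrite /bound; lra.
Qed.

(** The rotated pair stays close to its value [(E, 0)] at [x1]; rotating forward again recovers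
    [om Y]. *)
Lemma window_estimate :
  `|om * Y x2 + (eta x1 ^+ 2 + V x1 * psi x1 ^+ 2) * sin (th x2)|
    <= 2 * bound * `|x2 - x1|.
Proof.
have n1 (a : R) : `|sin a| <= 1 by exact: sin_max.
have n2 (a : R) : `|cos a| <= 1 by exact: cos_max.
have th1 : th x1 = 0 by rewrite /th subrr mulr0.
have Y1 : Y x1 = 0 by rewrite /Y mulrC subrr.
pose A t := Z t * cos (th t) - om * Y t * sin (th t).
pose B t := Z t * sin (th t) + om * Y t * cos (th t).
have A1 : A x1 = eta x1 ^+ 2 + V x1 * psi x1 ^+ 2.
  by rewrite /A th1 cos0 sin0 /Z; ring.
have B1 : B x1 = 0 by rewrite /B th1 sin0 Y1; ring.
have hA : `|A x2 - A x1| <= bound * `|x2 - x1|.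
  apply: (is_derive_lipschitz (fun t tw => dA (betw tw))) => t /betw tx.
  by apply: (le_trans (norm_bound _ _ (lexx _) (lexx _))) => //; exact: derivative_bounds.
have hB : `|B x2 - B x1| <= bound * `|x2 - x1|.
  apply: (is_derive_lipschitz (fun t tw => dB (betw tw))) => t /betw tx.
  rewrite -mulNr; apply: (le_trans (norm_bound _ _ (lexx _) (lexx _))) => //.
    by rewrite normrN.
  exact: derivative_bounds.
have -> : om * Y x2 + (eta x1 ^+ 2 + V x1 * psi x1 ^+ 2) * sin (th x2) =
    cos (th x2) * (B x2 - B x1) + - sin (th x2) * (A x2 - A x1).
  rewrite A1 B1 /A /B.
  transitivity (om * Y x2 * (cos (th x2) ^+ 2 + sin (th x2) ^+ 2)
     + (eta x1 ^+ 2 + V x1 * psi x1 ^+ 2) * sin (th x2)); last ring.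
  by rewrite cos2Dsin2 mulr1.
apply: (le_trans (norm_bound _ _ hB hA)) => //; first by rewrite normrN.
by lra.
Qed.

End Window.

(** * The Jacobi system *)

Section JacobiSystem.
Variables (R : realType) (a b : R) (p : nat -> {poly R}).
Hypotheses (a0 : 0 <= a) (b0 : 0 <= b) (op : jacobi_orthonormal a b p).
Variable n : nat.
Hypothesis n0 : (0 < n)%N.
Let k : R := n%:R + (a + b) / 2.
Let l (x : R) := b - a - (a + b) * x.
Local Notation w := (jacobi_weight a b).
Let y (x : R) := (p n).[x].
Let z (x : R) := (1 - x ^+ 2) * (p n)^`().[x] + l x / 2 * y x.
(** The leading factor is [n (n + a + b + 1) + (a + b) / 2]. Once the quadratic part is factored,
    this is [k^2 (x - r) (s - x) + k (1 - x^2)]. *)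
Let V (x : R) := (k ^+ 2 + k - (a + b) ^+ 2 / 4) * (1 - x ^+ 2) - l x ^+ 2 / 4.

Let ID := jacobi_functionalD a0 b0.
Let IZ := jacobi_functionalZ a0 b0.
Let IP := jacobi_functional_orthonormal op.
Let IBP := jacobi_functional_IBP a0 b0.

Lemma jacobi_ode_horner (x : R) :
  (1 - x ^+ 2) * (p n)^`()^`().[x] + (l x - 2 * x) * (p n)^`().[x] =
  - (n%:R * (n%:R + a + b + 1)) * y x.
Proof.
have := congr1 (fun q : {poly R} => q.[x]) (jacobi_ode ID IZ op.1 IP IBP n).
rewrite /jacobi_op !(hornerD, hornerN, hornerM, hornerZ, hornerC, hornerX, hornerXn).
by rewrite /y /l => <-.
Qed.

Lemma is_derive_jacobi_y (x : R) : -1 < x < 1 ->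
  is_derive x 1 y ((z x - l x / 2 * y x) / (1 - x ^+ 2)).
Proof.
move=> /one_sub_sqr_gt0 X; rewrite /y; is_derive_tac.
by rewrite /z addrK mulrAC divff ?mul1r// gt_eqF.
Qed.

Lemma is_derive_jacobi_z (x : R) : -1 < x < 1 ->
  is_derive x 1 z (- (V x * y x + l x / 2 * z x) / (1 - x ^+ 2)).
Proof.
move=> /one_sub_sqr_gt0 X; have ode := jacobi_ode_horner x.
rewrite /z /y /l; is_derive_tac.
have e : (1 - x ^+ 2) * (p n)^`()^`().[x] =
  - (n%:R * (n%:R + a + b + 1)) * (p n).[x] - (l x - 2 * x) * (p n)^`().[x].
  by rewrite -ode addrK.
apply: (@eq_trans _ _ (- (2 * x) * (p n)^`().[x] + (1 - x ^+ 2) * (p n)^`()^`().[x]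
  - (a + b) / 2 * (p n).[x] + l x / 2 * (p n)^`().[x])).
  by rewrite /l; field.
by rewrite e /V /z /y /l /k; field; rewrite gt_eqF.
Qed.

Lemma derivable_jacobi_y (x : R) : derivable y x 1.
Proof. by rewrite /y; derivable_tac. Qed.

Lemma derivable_jacobi_z (x : R) : derivable z x 1.
Proof. by rewrite /z /y /l; derivable_tac. Qed.

Definition jacobi_psi (x : R) := Num.sqrt (w x) * y x.
Definition jacobi_eta (x : R) := Num.sqrt (w x) * z x.

Lemma is_derive_sqrt_weight (x : R) : -1 < x < 1 ->
  is_derive x 1 (fun t => Num.sqrt (w t)) (Num.sqrt (w x) * l x / 2 / (1 - x ^+ 2)).
Proof.
move=> x1; have X := one_sub_sqr_gt0 x1; have w0 := weight_gt0 a b x1.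
apply: (is_derive_val (is_derive_sqrt_comp w0 (is_derive_weight a b x1))).
have s0 : 0 < Num.sqrt (w x) by rewrite sqrtr_gt0.
rewrite -{1}(sqr_sqrtr (ltW w0)) -/(l x); move: (Num.sqrt (w x)) s0 => q q0.
by field; rewrite !gt_eqF.
Qed.

Lemma is_derive_jacobi_psi (x : R) : -1 < x < 1 ->
  is_derive x 1 jacobi_psi (jacobi_eta x / (1 - x ^+ 2)).
Proof.
move=> x1; have X := one_sub_sqr_gt0 x1.
have ds := is_derive_sqrt_weight x1; have dy := is_derive_jacobi_y x1.
apply: (is_derive_val (is_derive_mul ds dy)).
by rewrite /jacobi_eta; field; rewrite gt_eqF.
Qed.

Lemma is_derive_jacobi_eta (x : R) : -1 < x < 1 ->
  is_derive x 1 jacobi_eta (- (V x * jacobi_psi x) / (1 - x ^+ 2)).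
Proof.
move=> x1; have X := one_sub_sqr_gt0 x1.
have ds := is_derive_sqrt_weight x1; have dz := is_derive_jacobi_z x1.
apply: (is_derive_val (is_derive_mul ds dz)).
by rewrite /jacobi_psi; field; rewrite gt_eqF.
Qed.

(** In the Christoffel-Darboux difference the constant [(b - a) / 2] cancels, and [k x] produces the
    term [- k psi(x) psi(t)]. *)
Lemma cd_partner_horner (x : R) :
  (cd_partner p n).[x] = z x + (k * x - (b - a) / 2) * y x.
Proof.
rewrite /cd_partner !(hornerD, hornerN, hornerM, hornerZ, hornerC, hornerX, hornerXn).
by rewrite /z /y /l /k; field.
Qed.

Lemma jacobi_kernel_offdiag (x t : R) : x != t ->
  (2 * k + 1) * jacobi_kernel a b p n x t =
  (jacobi_psi x * jacobi_eta t - jacobi_eta x * jacobi_psi t) / (x - t)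
  - k * jacobi_psi x * jacobi_psi t.
Proof.
move=> xt; have xt0 : x - t != 0 by rewrite subr_eq0.
have := christoffel_darboux ID IZ op.1 IP IBP x t n0.
have kE : 2 * n%:R + 1 + a + b = 2 * k + 1 by rewrite /k; field.
have K0 : 0 < 2 * k + 1.
  by rewrite -kE; have : (0 : R) <= n%:R by []; have := a0; have := b0; lra.
rewrite !cd_partner_horner kE => cd; move: (k) K0 {kE} cd => k' K0 cd.
rewrite /jacobi_kernel /jacobi_psi /jacobi_eta.
move: cd; rewrite -/(y x) -/(y t); set S := \sum_(j < n) _ => cd.
have -> : S = (y x * (z t + (k' * t - (b - a) / 2) * y t) -
    (z x + (k' * x - (b - a) / 2) * y x) * y t) / (x - t) / (2 * k' + 1).
  by rewrite -cd; field; rewrite xt0 gt_eqF.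
by field; rewrite xt0 gt_eqF.
Qed.

Lemma jacobi_kernel_diag (x : R) : -1 < x < 1 ->
  (2 * k + 1) * jacobi_kernel a b p n x x =
  (jacobi_eta x ^+ 2 + V x * jacobi_psi x ^+ 2) / (1 - x ^+ 2) - k * jacobi_psi x ^+ 2.
Proof.
move=> x1; have X := one_sub_sqr_gt0 x1.
have cd := christoffel_darboux_diag ID IZ op.1 IP IBP x n0.
(* Differentiating through [z] brings in the Jacobi equation, so no second derivative of [p n] is
   left. *)
have dcd : (cd_partner p n)^`().[x] =
  - (V x * y x + l x / 2 * z x) / (1 - x ^+ 2)
  + (k * y x + (k * x - (b - a) / 2) * ((z x - l x / 2 * y x) / (1 - x ^+ 2))).
  have dy := is_derive_jacobi_y x1; have dz := is_derive_jacobi_z x1.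
  have d1 : is_derive x 1 (fun t => z t + (k * t - (b - a) / 2) * y t)
   (- (V x * y x + l x / 2 * z x) / (1 - x ^+ 2)
  + (k * y x + (k * x - (b - a) / 2) * ((z x - l x / 2 * y x) / (1 - x ^+ 2)))).
    by is_derive_tac; ring.
  have d2 := is_derive_horner (cd_partner p n) x.
  have e : (fun t => (cd_partner p n).[t]) = (fun t => z t + (k * t - (b - a) / 2) * y t).
    by apply/funext => t; rewrite cd_partner_horner.
  rewrite e in d2.
  have -> := esym (@derive_val _ _ _ _ _ _ _ d2).
  exact: derive_val.
have dp : (p n)^`().[x] = (z x - l x / 2 * y x) / (1 - x ^+ 2).
  by rewrite /z addrK mulrAC divff ?mul1r// gt_eqF.
rewrite dcd dp cd_partner_horner -/(y x) in cd.
rewrite /jacobi_kernel /jacobi_psi /jacobi_eta -expr2.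
have -> : 2 * k + 1 = 2 * n%:R + 1 + a + b by rewrite /k; field.
rewrite mulrCA cd; field; rewrite gt_eqF//.
Qed.

End JacobiSystem.

(** * Energy bounds for the Jacobi functions *)

Section JacobiBulk.
Variables (R : realType) (a b : R) (p : nat -> {poly R}).
Hypotheses (a0 : 0 <= a) (b0 : 0 <= b) (op : jacobi_orthonormal a b p).
Variable n : nat.
Hypothesis n0 : (0 < n)%N.
Let k : R := n%:R + (a + b) / 2.
Variables (r s : R).
Hypotheses (rs : r < s) (rm1 : -1 <= r) (s1 : s <= 1).
Hypothesis quad : forall x, k ^+ 2 * ((x - r) * (s - x)) =
  (k ^+ 2 - (a + b) ^+ 2 / 4) * (1 - x ^+ 2) - (b - a - (a + b) * x) ^+ 2 / 4.
Local Notation psi := (jacobi_psi a b p n).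
Local Notation eta := (jacobi_eta a b p n).
Let V x := k ^+ 2 * ((x - r) * (s - x)) + k * (1 - x ^+ 2).

Lemma jacobi_k_ge1 : 1 <= k.
Proof.
have n1 : (1 : R) <= n%:R by rewrite ler1n.
by rewrite /k; have := a0; have := b0; lra.
Qed.
Let k1 := jacobi_k_ge1.

Lemma jacobi_quad_le (x : R) : 0 < (x - r) * (s - x) ->
  (x - r) * (s - x) <= 1 - x ^+ 2.
Proof.
move=> /(P_gt0_itv rs rm1 s1)/one_sub_sqr_gt0 X.
have k0 : 0 < k ^+ 2 by rewrite exprn_gt0// (lt_le_trans ltr01 k1).
rewrite -(ler_pM2l k0) quad.
have h1 : 0 <= (a + b) ^+ 2 * (1 - x ^+ 2) by rewrite mulr_ge0 ?sqr_ge0 ?ltW.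
have h2 := sqr_ge0 (b - a - (a + b) * x).
lra.
Qed.

Let VE x : (k ^+ 2 + k - (a + b) ^+ 2 / 4) * (1 - x ^+ 2)
   - (b - a - (a + b) * x) ^+ 2 / 4 = V x.
Proof. by rewrite /V quad; ring. Qed.

Definition jacobi_energy (x : R) := eta x ^+ 2 + V x * psi x ^+ 2.

Lemma jacobi_energyP (p1 x : R) : 0 < p1 -> p1 <= (x - r) * (s - x) ->
  8 * gauge_bound p1 <= k * p1 ->
  [/\ `|jacobi_energy x - 2 * k ^+ 2 * Num.sqrt ((x - r) * (s - x)) / pi| <=
    (10 * gauge_bound p1 + (8 * gauge_bound p1 + 80 * gauge_bound p1 ^+ 2) / p1) * k,
    jacobi_energy x <= (2 + 20 * gauge_bound p1) * k ^+ 2 &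
    p1 * k ^+ 2 * psi x ^+ 2 <= jacobi_energy x].
Proof.
move=> p10 Px kp.
pose y (x : R) := (p n).[x].
pose l (x : R) := b - a - (a + b) * x.
pose z (x : R) := (1 - x ^+ 2) * (p n)^`().[x] + l x / 2 * y x.
have w0 x' : 0 <= jacobi_weight a b x' by exact: weight_ge0.
have cw := within_continuous_weight a0 b0.
have dw (x' : R) : -1 < x' < 1 -> is_derive x' 1 (jacobi_weight a b)
  (jacobi_weight a b x' * l x' / (1 - x' ^+ 2)) by exact: is_derive_weight.
have dy (x' : R) : -1 < x' < 1 -> is_derive x' 1 y ((z x' - l x' / 2 * y x') / (1 - x' ^+ 2)).
  exact: is_derive_jacobi_y.
have dz (x' : R) : -1 < x' < 1 ->
    is_derive x' 1 z (- (V x' * y x' + l x' / 2 * z x') / (1 - x' ^+ 2)).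
  by move=> x1; have := is_derive_jacobi_z a0 b0 op n x1; rewrite -/k VE.
have zl : z (-1) = l (-1) / 2 * y (-1).
  by rewrite /z (_ : 1 - (-1) ^+ 2 = 0 :> R) ?mul0r ?add0r//; ring.
have zr : z 1 = l 1 / 2 * y 1.
  by rewrite /z (_ : 1 - 1 ^+ 2 = 0 :> R) ?mul0r ?add0r//; ring.
have Pl : k ^+ 2 * ((-1 - r) * (s - -1)) = - (l (-1) ^+ 2 / 4).
  by rewrite quad /l; ring.
have Pr : k ^+ 2 * ((1 - r) * (s - 1)) = - (l 1 ^+ 2 / 4).
  by rewrite quad /l; ring.
have cJ : {within `[-1, 1], continuous (jacobi_mass a b p n)}.
  exact: within_continuous_jacobi_mass.
have dJ (x' : R) : -1 < x' < 1 -> is_derive x' 1 (jacobi_mass a b p n)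
    (y x' ^+ 2 * jacobi_weight a b x') by exact: is_derive_jacobi_mass.
have EE : energy k r s (jacobi_weight a b) y z x = jacobi_energy x.
  rewrite /energy /jacobi_energy /jacobi_eta /jacobi_psi !exprMn sqr_sqrtr//.
  by rewrite -/(V x) /z /y /l; ring.
have cy (x' : R) : derivable y x' 1 by exact: derivable_jacobi_y.
have cz (x' : R) : derivable z x' 1 by exact: derivable_jacobi_z.
have Jl : jacobi_mass a b p n (-1) = 0 by exact: jacobi_mass_left.
have Jr : jacobi_mass a b p n 1 = 1 by exact: jacobi_mass_right.
have [e1 e2] := energy_asymptotics k1 w0 cw dw dy dz cy cz zl zr Pl Pr cJ dJ
  rs rm1 s1 jacobi_quad_le Jl Jr p10 Px kp.
have [e3 _] := energy_psi y z k1 w0 rs rm1 s1 jacobi_quad_le p10 Px.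
rewrite EE in e1 e2 e3; split => //.
apply: le_trans e3; rewrite /jacobi_psi exprMn sqr_sqrtr//.
Qed.

End JacobiBulk.

(** * The sine kernel *)

Lemma norm_sin_le (R : realType) (t : R) : `|sin t| <= `|t|.
Proof.
have := @is_derive_lipschitz R sin cos 1 0 t.
rewrite sin0 !subr0 mul1r; apply => t' _; exact: cos_max.
Qed.

Lemma norm_sinc_le1 (R : realType) (t : R) : `|sinc t| <= 1.
Proof.
rewrite /sinc; case: eqP => [_|/eqP t0]; first by rewrite normr1.
have pt : 0 < `|pi * t| by rewrite normr_gt0 mulf_neq0// gt_eqF// pi_gt0.
by rewrite normrM normfV ler_pdivrMr// mul1r norm_sin_le.
Qed.

Section BulkSineKernel.
Variables (R : realType) (p0 T : R).
Hypotheses (p00 : 0 < p0) (T0 : 0 <= T).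
(** On the whole window [p1] bounds [P] from below, [S] bounds [psi] and [eta / k], and [C1 k]
    bounds the energy error; [T'] bounds [k] times the radius. *)
Let p1 := p0 / 2.
Let M1 := gauge_bound p1.
Let S := (2 + 20 * M1) / p1.
Let T' := 4 * T / p0.
Let C1 := 10 * M1 + (8 * M1 + 80 * M1 ^+ 2) / p1.
Let B0 := S ^+ 2 * (8 + 18 * T' / p1 ^+ 2).
Let C2 := 8 * B0 / p0 ^+ 2 + 4 * S ^+ 2 / p0.
Let C3 := 4 * (2 + 20 * M1) * (2 * T' / p1 ^+ 2) / p0 + 4 * S ^+ 2 / p0.
Let C5 := 4 * C1 / p0 + 10 * T' / p0 ^+ 2.
(** It depends only on [p0] and [T], whence the uniformity. [C2] and [C3] are the errors off and on
    the diagonal, [C5] that of the energy, and [1] is the gap between [2 k] and [2 k + 1]. *)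
Definition sine_error : R := C2 + C3 + C5 + 1.
(** The first term forces [delta <= p0 / 10], the second [8 * M1 <= k * p1]. *)
Definition sine_threshold : R := 40 * T / p0 ^+ 2 + 16 * M1 / p0.

Let p10 : 0 < p1. Proof. by rewrite divr_gt0. Qed.
Let M10 : 0 < M1. Proof. by rewrite divr_gt0// exprn_gt0// divr_gt0. Qed.
Let T'0 : 0 <= T'. Proof. by rewrite divr_ge0 ?(ltW p00)// mulr_ge0. Qed.
Let S0 : 0 < S. Proof. by rewrite divr_gt0// addr_gt0// mulr_gt0. Qed.
Let C10 : 0 <= C1.
Proof.
apply: addr_ge0; first by rewrite mulr_ge0// ltW.
apply: divr_ge0; last exact: ltW.
by apply: addr_ge0; rewrite mulr_ge0 ?sqr_ge0// ltW.
Qed.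
Let B00 : 0 <= B0.
Proof.
apply: mulr_ge0; first exact: sqr_ge0.
apply: addr_ge0 => //; apply: divr_ge0; last exact: sqr_ge0.
exact: mulr_ge0.
Qed.

Variables (a b : R) (p : nat -> {poly R}).
Hypotheses (a0 : 0 <= a) (b0 : 0 <= b) (op : jacobi_orthonormal a b p).
Variable n : nat.
Hypothesis n0 : (0 < n)%N.
Let k : R := n%:R + (a + b) / 2.
Variables (r s : R).
Hypotheses (rs : r < s) (rm1 : -1 <= r) (s1 : s <= 1).
Hypothesis quad : forall x, k ^+ 2 * ((x - r) * (s - x)) =
  (k ^+ 2 - (a + b) ^+ 2 / 4) * (1 - x ^+ 2) - (b - a - (a + b) * x) ^+ 2 / 4.
Hypothesis kK : sine_threshold <= k.
Variable x : R.
Let P t := (t - r) * (s - t).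
Hypothesis Px : p0 <= P x.
Local Notation psi := (jacobi_psi a b p n).
Local Notation eta := (jacobi_eta a b p n).
Local Notation E := (jacobi_energy a b p n r s).
Let V t := k ^+ 2 * P t + k * (1 - t ^+ 2).
Let om := k * Num.sqrt (P x).
(** The mean spacing [1 / (n f_n(x))], by [inv_n_f_seq]. *)
Let h := pi * (1 - x ^+ 2) / om.
Let k1 : 1 <= k := jacobi_k_ge1 a0 b0 n0.
Let k0 : 0 < k := lt_le_trans ltr01 k1.
Let P_le := jacobi_quad_le a0 b0 n0 rs rm1 s1 quad.

Let Px0 : 0 < P x. Proof. exact: lt_le_trans Px. Qed.
Let x1 : -1 < x < 1. Proof. exact: P_gt0_itv Px0. Qed.
Let X0 : 0 < 1 - x ^+ 2. Proof. exact: one_sub_sqr_gt0. Qed.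
Let X1 : 1 - x ^+ 2 <= 1. Proof. by rewrite lerBlDr lerDl sqr_ge0. Qed.
Let P1 : P x <= 1. Proof. exact: le_trans (P_le Px0) X1. Qed.
Let p01 : p0 <= 1. Proof. exact: le_trans Px P1. Qed.
Let sq_ge (t : R) : p0 <= t -> p0 <= Num.sqrt t.
Proof.
move=> pt; rewrite -(ger0_norm (ltW p00)) -sqrtr_sqr ler_wsqrtr//.
by apply: le_trans pt; rewrite expr2 ler_piMl// ltW.
Qed.

Let om0 : 0 < om. Proof. by rewrite mulr_gt0// sqrtr_gt0. Qed.
Let om_ge : k * p0 <= om. Proof. by rewrite ler_wpM2l ?(ltW k0)// sq_ge. Qed.
Let h0 : 0 < h. Proof. by apply: divr_gt0 => //; apply: mulr_gt0 => //; exact: pi_gt0. Qed.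
Let pi4 : pi <= 4 :> R.
Proof. by have := @pihalf_lt2 R; lra. Qed.

Let kh : k * h <= 4 / p0.
Proof.
have q0 : 0 < Num.sqrt (P x) by rewrite sqrtr_gt0.
have -> : k * h = pi * (1 - x ^+ 2) / Num.sqrt (P x).
  rewrite /h /om; move: (Num.sqrt (P x)) q0 (k) k0 => q q0 k' k0'.
  by field; rewrite !gt_eqF.
have pX : pi * (1 - x ^+ 2) <= 4.
  by rewrite -[leRHS]mulr1; apply: ler_pM => //; apply: ltW => //; exact: pi_gt0.
apply: ler_pM => //.
- by apply: mulr_ge0; apply: ltW => //; exact: pi_gt0.
- by rewrite lef_pV2// sq_ge.
Qed.

Let delta := T * h.
Let delta0 : 0 <= delta. Proof. by rewrite mulr_ge0// ltW. Qed.
Let kdelta : k * delta <= T'.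
Proof.
rewrite /delta mulrCA /T' mulrAC mulrC ler_wpM2r//.
Qed.

Let delta_le : delta <= p0 / 10.
Proof.
rewrite -(ler_pM2l k0); apply: (le_trans kdelta).
have : 40 * T / p0 ^+ 2 <= k.
  apply: le_trans kK; rewrite /sine_threshold lerDl.
  by apply: divr_ge0; [rewrite mulr_ge0// ltW|exact: ltW].
rewrite ler_pdivrMr ?exprn_gt0// => hk.
rewrite /T' ler_pdivrMr//; lra.
Qed.

Let kM : 8 * M1 <= k * p1.
Proof.
have : 16 * M1 / p0 <= k.
  apply: le_trans kK; rewrite /sine_threshold lerDr.
  by apply: divr_ge0; [rewrite mulr_ge0|exact: sqr_ge0].
by rewrite ler_pdivrMr// /p1; lra.
Qed.

(** The constant is [5] rather than [4] because [t] is not yet known to lie in (-1, 1). *)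
Let Pwin t : `|t - x| <= delta -> `|P t - P x| <= 5 * `|t - x|.
Proof.
move=> tx; have -> : P t - P x = (r + s - t - x) * (t - x) by rewrite /P; ring.
rewrite normrM ler_wpM2r//; have [? ?] := andP x1.
have h1 := rm1; have h2 := s1; have h3 := rs; have h4 := p01; have h5 := delta_le.
move: tx; rewrite !ler_norml => /andP[? ?]; apply/andP; split; lra.
Qed.

Let Pge t : `|t - x| <= delta -> p1 <= P t.
Proof.
move=> tx; have := Pwin tx; rewrite ler_norml => /andP[q _].
by have h5 := delta_le; have h6 := Px; rewrite /p1; lra.
Qed.

Let Ewin t : `|t - x| <= delta ->
  [/\ `|E t - 2 * k ^+ 2 * Num.sqrt (P t) / pi| <= C1 * k, E t <= (2 + 20 * M1) * k ^+ 2,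
   `|psi t| <= S & `|eta t| <= S * k].
Proof.
move=> /Pge pt.
have [e1 e2 e3] := jacobi_energyP a0 b0 op n0 rs rm1 s1 quad p10 pt kM.
have p11 : p1 <= 1 by have := p01; rewrite /p1; lra.
have S1 : 1 <= S.
  by rewrite /S ler_pdivlMr// mul1r; have := M10; lra.
(* [psi^2 <= S] and [eta^2 <= S k^2] are weakened to squares, which avoids a root in [S]. *)
have SS : S <= S ^+ 2 by rewrite expr2 ler_peMl// ltW.
have k20 : 0 < k ^+ 2 by exact: exprn_gt0.
split => //.
  rewrite -ler_sqr ?nnegrE ?(ltW S0)// real_normK ?num_real//; apply: le_trans SS.
  rewrite /S ler_pdivlMr// -(ler_pM2r k20); apply: le_trans e2.
  by apply: le_trans e3; rewrite le_eqVlt; apply/orP; left; apply/eqP; rewrite /k; ring.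
have Sk : 0 <= S * k by rewrite mulr_ge0// ltW.
rewrite -ler_sqr ?nnegrE// real_normK ?num_real// [leRHS]exprMn.
apply: (@le_trans _ _ (E t)).
  rewrite /jacobi_energy lerDl; apply: mulr_ge0; last exact: sqr_ge0.
  apply: addr_ge0; apply: mulr_ge0; [exact: sqr_ge0| |exact: ltW|].
    by apply: le_trans pt; exact: ltW.
  by apply/ltW/one_sub_sqr_gt0/(P_gt0_itv rs rm1 s1)/(lt_le_trans p10).
apply: (le_trans e2); rewrite ler_wpM2r ?(ltW k20)//; apply: le_trans SS.
by rewrite /S ler_peMr ?invf_ge1// addr_ge0// mulr_ge0// ltW.
Qed.

Let VE t : (k ^+ 2 + k - (a + b) ^+ 2 / 4) * (1 - t ^+ 2)
   - (b - a - (a + b) * t) ^+ 2 / 4 = V t.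
Proof. by rewrite /V /P quad; ring. Qed.

Let dpsi (t : R) : -1 < t < 1 -> is_derive t 1 psi (eta t / (1 - t ^+ 2)).
Proof. exact: is_derive_jacobi_psi. Qed.

Let deta (t : R) : -1 < t < 1 -> is_derive t 1 eta (- (V t * psi t) / (1 - t ^+ 2)).
Proof. by move=> t1; rewrite -VE; exact: is_derive_jacobi_eta. Qed.

Let psiwin t : `|t - x| <= delta -> `|psi t| <= S.
Proof. by case/Ewin. Qed.

Let etawin t : `|t - x| <= delta -> `|eta t| <= S * k.
Proof. by case/Ewin. Qed.

Let shift_win u : `|u| <= T -> `|x + u * h - x| <= delta.
Proof. by move=> uT; rewrite addrC addKr normrM (gtr0_norm h0) ler_wpM2r// ltW. Qed.

Let omh : om * h = pi * (1 - x ^+ 2).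
Proof. by rewrite /h mulrC divfK// gt_eqF. Qed.

Let kom : k / om <= p0^-1.
Proof. by rewrite ler_pdivrMr// mulrC ler_pdivlMr. Qed.

Let psi_term x1' x2' : `|x1' - x| <= delta -> `|x2' - x| <= delta ->
  `|h * (k * psi x1' * psi x2')| <= 4 * S ^+ 2 / p0.
Proof.
move=> /psiwin h1 /psiwin h2.
have -> : h * (k * psi x1' * psi x2') = k * h * (psi x1' * psi x2') by ring.
have kh0 : 0 <= k * h by rewrite mulr_ge0// ltW.
rewrite normrM (ger0_norm kh0) (normrM (psi x1')).
rewrite [leRHS](_ : _ = 4 / p0 * (S * S)); last by ring.
by apply: ler_pM => //; exact: ler_pM.
Qed.

(** The error in [window_estimate] is proportional to the distance [|u - v| h] of the two points, so
    division by [u - v] leaves a bound uniform as [v] tends to [u]. *)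
Lemma kernel_offdiag_estimate u v : `|u| <= T -> `|v| <= T -> u != v ->
  `|h * ((2 * k + 1) * jacobi_kernel a b p n (x + u * h) (x + v * h))
    - E (x + u * h) * (pi / om) * sinc (u - v)| <= C2.
Proof.
move=> uT vT uv; have w1 := shift_win uT; have w2 := shift_win vT.
have uv0 : u - v != 0 by rewrite subr_eq0.
have h0' : h != 0 by rewrite gt_eqF.
have om0' : om != 0 by rewrite gt_eqF.
have pt := psi_term w1 w2.
have we := window_estimate k1 rm1 s1 rs p10 P_le dpsi deta delta0 kdelta Pge psiwin etawin w1 w2.
set x1' := x + u * h in w1 pt we *; set x2' := x + v * h in w2 pt we *.
have x12 : x1' - x2' = (u - v) * h by rewrite /x1' /x2'; ring.
have x12n : x1' != x2' by rewrite -subr_eq0 x12 mulf_neq0.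
rewrite jacobi_kernel_offdiag// -/k x12.
set Y := psi x1' * eta x2' - eta x1' * psi x2' in we *.
have thE : om / (1 - x ^+ 2) * (x2' - x1') = - (pi * (u - v)).
  rewrite -[x2' - x1']opprB x12.
  rewrite [LHS](_ : _ = - (om * h / (1 - x ^+ 2) * (u - v))); last by ring.
  by rewrite omh mulfK ?gt_eqF.
move: we; cbv beta; rewrite -/(P x) -/om thE sinN -[x2' - x1']opprB x12 normrN.
rewrite -/(jacobi_energy a b p n r s x1') => we.
have pi0 : pi != 0 :> R by rewrite gt_eqF// pi_gt0.
have -> : h * (Y / ((u - v) * h) - k * psi x1' * psi x2')
    - E x1' * (pi / om) * sinc (u - v) =
    (om * Y + E x1' * - sin (pi * (u - v))) / (om * (u - v))
    - h * (k * psi x1' * psi x2').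
  rewrite /sinc (negbTE uv0); move: (sin _) => sn.
  move: (pi : R) pi0 => c c0.
  by field; rewrite h0' om0' uv0 c0.
apply: (le_trans (ler_normB _ _)); rewrite /C2; apply: lerD => //.
rewrite normrM normfV ler_pdivrMr; last by rewrite normr_gt0 mulf_neq0.
apply: (le_trans we).
rewrite (normrM (u - v)) (normrM om) (gtr0_norm h0) (gtr0_norm om0).
have kk : k ^+ 2 * h <= 4 / p0 ^+ 2 * om.
  apply: (@le_trans _ _ (4 / p0 * k)); first by rewrite expr2 mulrAC ler_wpM2r// ltW.
  rewrite [leRHS](_ : _ = 4 / p0 * (om / p0)); last by field; rewrite gt_eqF.
  by rewrite ler_wpM2l ?divr_ge0 ?(ltW p00)// ler_pdivlMr.
rewrite -/B0 [leLHS](_ : _ = 2 * B0 * `|u - v| * (k ^+ 2 * h)); last by ring.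
rewrite [leRHS](_ : _ = 2 * B0 * `|u - v| * (4 / p0 ^+ 2 * om)); last by ring.
by apply: ler_wpM2l => //; apply: mulr_ge0 => //; exact: mulr_ge0.
Qed.

(** Since [pi / om = h / (1 - x^2)], the confluent formula differs from the claim by the change of
    [1 / (1 - t^2)] over the window and by the [psi^2] term. *)
Lemma kernel_diag_estimate u : `|u| <= T ->
  `|h * ((2 * k + 1) * jacobi_kernel a b p n (x + u * h) (x + u * h))
    - E (x + u * h) * (pi / om)| <= C3.
Proof.
move=> uT; have w1 := shift_win uT; have pt := psi_term w1 w1.
have inv := inv_one_sub_sqr_lipschitz k1 p10 P_le delta0 kdelta Pge w1.
have [_ e1 _ _] := Ewin w1; have Pp := Pge w1.
set x1' := x + u * h in w1 pt inv e1 Pp *.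
have x1i : -1 < x1' < 1 by apply: (P_gt0_itv rs rm1 s1); exact: lt_le_trans Pp.
rewrite jacobi_kernel_diag// -/k VE.
rewrite (_ : eta x1' ^+ 2 + _ = E x1')//.
have hE : pi / om = h / (1 - x ^+ 2) by rewrite /h mulrAC mulfK ?gt_eqF.
have -> : h * (E x1' / (1 - x1' ^+ 2) - k * psi x1' ^+ 2)
    - E x1' * (pi / om) =
    h * (E x1' * ((1 - x1' ^+ 2)^-1 - (1 - x ^+ 2)^-1)) - h * (k * psi x1' * psi x1').
  by rewrite hE; ring.
apply: (le_trans (ler_normB _ _)); rewrite /C3; apply: lerD => //.
have E0 : 0 <= E x1'.
  have [_ _] := jacobi_energyP a0 b0 op n0 rs rm1 s1 quad p10 Pp kM.
  by apply: le_trans; rewrite mulr_ge0 ?sqr_ge0// mulr_ge0 ?sqr_ge0// ltW.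
rewrite (normrM h) (normrM (E x1')) (gtr0_norm h0) (ger0_norm E0).
have k20 : 0 < k ^+ 2 by exact: exprn_gt0.
apply: (@le_trans _ _ (h * ((2 + 20 * M1) * k ^+ 2 * (2 * T' / p1 ^+ 2 / k)))).
  by rewrite ler_wpM2l ?(ltW h0)//; apply: ler_pM.
rewrite [leLHS](_ : _ = k * h * ((2 + 20 * M1) * (2 * T' / p1 ^+ 2))); last first.
  by field; rewrite !gt_eqF.
rewrite [leRHS](_ : _ = 4 / p0 * ((2 + 20 * M1) * (2 * T' / p1 ^+ 2))); last by ring.
rewrite ler_wpM2r//; apply: mulr_ge0.
  by rewrite addr_ge0// mulr_ge0// ltW.
by apply: divr_ge0; [rewrite mulr_ge0|exact: sqr_ge0].
Qed.

(** The main term of the energy contributes [2 k sqrt (P t) / sqrt (P x)], and [P] changes by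
    [O(1 / k)] over the window. *)
Lemma energy_window_estimate u : `|u| <= T ->
  `|E (x + u * h) * (pi / om) - 2 * k| <= C5.
Proof.
move=> uT; have w1 := shift_win uT; have [e1 _ _ _] := Ewin w1.
have pw := Pwin w1; have Pp := Pge w1.
set t := x + u * h in w1 e1 pw Pp *.
have Pt0 : 0 < P t by exact: lt_le_trans Pp.
have q0 : 0 < Num.sqrt (P x) by rewrite sqrtr_gt0.
have q1 := sq_ge Px.
have qt0 : 0 <= Num.sqrt (P t) by exact: sqrtr_ge0.
have qq : `|Num.sqrt (P t) - Num.sqrt (P x)| * p0 <= 5 * delta.
  apply: (@le_trans _ _ (`|P t - P x|)); last by apply: (le_trans pw); rewrite ler_wpM2l.
  rewrite -[in leRHS](sqr_sqrtr (ltW Pt0)) -[in leRHS](sqr_sqrtr (ltW Px0)) subr_sqr.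
  rewrite normrM ler_wpM2l// ger0_norm ?addr_ge0 ?(ltW q0)//.
  by apply: (le_trans q1); rewrite lerDr.
have pi0 : 0 < pi :> R by exact: pi_gt0.
have -> : E t * (pi / om) - 2 * k =
   (E t - 2 * k ^+ 2 * Num.sqrt (P t) / pi) * (pi / om)
   + 2 * k * ((Num.sqrt (P t) - Num.sqrt (P x)) / Num.sqrt (P x)).
  rewrite /om; move: (Num.sqrt (P x)) q0 (pi : R) pi0 (k) k0 => q q0 c c0 k' k0'.
  by field; rewrite !gt_eqF.
apply: (le_trans (ler_normD _ _)); rewrite /C5; apply: lerD.
  rewrite normrM (gtr0_norm (divr_gt0 pi0 om0)).
  apply: (@le_trans _ _ (C1 * k * (pi / om))).
    by apply: ler_wpM2r => //; apply/ltW/divr_gt0.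
  rewrite [leLHS](_ : _ = C1 * (pi * (k / om))); last by ring.
  rewrite [leRHS](_ : _ = C1 * (4 / p0)); last by ring.
  by rewrite ler_wpM2l//; apply: ler_pM => //; rewrite ?divr_ge0 ?(ltW pi0) ?(ltW k0) ?(ltW om0).
have k20 : 0 <= 2 * k by rewrite mulr_ge0// ltW.
rewrite normrM (ger0_norm k20) normrM normfV (gtr0_norm q0).
rewrite [leRHS](_ : _ = 2 * (5 * T' / p0 ^+ 2)); last by ring.
rewrite -(mulrA 2 k) ler_wpM2l//.
apply: (@le_trans _ _ (k * (5 * delta / p0 / p0))).
  rewrite ler_wpM2l ?(ltW k0)//; apply: ler_pM; rewrite ?invr_ge0 ?(ltW q0)//.
    by rewrite ler_pdivlMr.
  by rewrite lef_pV2.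
rewrite [leLHS](_ : _ = 5 * (k * delta) / p0 ^+ 2); last by field; rewrite gt_eqF.
by rewrite ler_wpM2r ?invr_ge0 ?sqr_ge0// ler_wpM2l.
Qed.

Lemma bulk_sine_kernel u v : `|u| <= T -> `|v| <= T ->
  `|h * jacobi_kernel a b p n (x + u * h) (x + v * h) - sinc (u - v)| <= sine_error / k.
Proof.
move=> uT vT; set K := jacobi_kernel _ _ _ _ _ _.
have S1 := norm_sinc_le1 (u - v).
have C20 : 0 <= C2.
  apply: addr_ge0; apply: divr_ge0; rewrite ?sqr_ge0 ?(ltW p00)//.
    exact: mulr_ge0.
  by rewrite mulr_ge0// sqr_ge0.
have C30 : 0 <= C3.
  apply: addr_ge0; apply: divr_ge0; rewrite ?(ltW p00)//.
    apply: mulr_ge0; first by rewrite mulr_ge0// addr_ge0// mulr_ge0// ltW.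
    by apply: divr_ge0; [rewrite mulr_ge0|exact: sqr_ge0].
  by rewrite mulr_ge0// sqr_ge0.
have e1 : `|h * ((2 * k + 1) * K) - E (x + u * h) * (pi / om) * sinc (u - v)| <= C2 + C3.
  have [uv|uv] := eqVneq u v.
    rewrite /K -uv subrr /sinc eqxx mulr1.
    by apply: (le_trans (kernel_diag_estimate uT)); rewrite lerDr.
  by apply: (le_trans (kernel_offdiag_estimate uT vT uv)); rewrite lerDl.
have e2 := energy_window_estimate uT.
move: e1 e2; move: (E (x + u * h) * (pi / om)) (sinc (u - v)) S1 => e sn S1 e1 e2.
(* The energy yields [2 k], the Christoffel-Darboux factor is [2 k + 1]; the difference costs the
   extra [1]. *)
have e3 : `|(e - (2 * k + 1)) * sn| <= C5 + 1.
  rewrite normrM -[leRHS]mulr1; apply: ler_pM => //.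
  have -> : e - (2 * k + 1) = (e - 2 * k) - 1 by ring.
  by apply: (le_trans (ler_normB _ _)); rewrite normr1 lerD2r.
have K0 : 0 < 2 * k + 1 by rewrite addr_gt0// mulr_gt0.
have -> : h * K - sn = ((h * ((2 * k + 1) * K) - e * sn) + (e - (2 * k + 1)) * sn) / (2 * k + 1).
  by field; rewrite gt_eqF.
rewrite normrM normfV (gtr0_norm K0).
apply: ler_pM => //; first by rewrite invr_ge0 ltW.
  by apply: (le_trans (ler_normD _ _)); rewrite /sine_error -addrA; apply: lerD.
by rewrite lef_pV2//; have := k0; lra.
Qed.

End BulkSineKernel.

(** * The density and its limits *)

Section DensityFacts.
Variables (R : realType) (a b : nat -> R).
Hypotheses (ha : forall n, 0 <= a n) (hb : forall n, 0 <= b n).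
Variable n : nat.
Hypothesis n0 : (0 < n)%N.
Let k : R := n%:R + (a n + b n) / 2.

Let N0 : 0 < n%:R :> R. Proof. by rewrite ltr0n. Qed.
Let k0 : 0 < k.
Proof. by rewrite ltr_wpDr// divr_ge0// addr_ge0. Qed.
Let n_le_k : n%:R <= k. Proof. by rewrite lerDl divr_ge0// addr_ge0. Qed.

Lemma A_seqE : A_seq a b n = a n / (2 * k).
Proof.
rewrite /A_seq /alpha_seq /beta_seq.
have -> : 2 + a n / n%:R + b n / n%:R = 2 * k / n%:R.
  by rewrite /k; field; rewrite gt_eqF.
by field; rewrite !gt_eqF.
Qed.

Lemma B_seqE : B_seq a b n = b n / (2 * k).
Proof.
rewrite /B_seq /alpha_seq /beta_seq.
have -> : 2 + a n / n%:R + b n / n%:R = 2 * k / n%:R.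
  by rewrite /k; field; rewrite gt_eqF.
by field; rewrite !gt_eqF.
Qed.

Let A := A_seq a b n.
Let B := B_seq a b n.
Let A0 : 0 <= A. Proof. by rewrite /A A_seqE divr_ge0// mulr_ge0// ltW. Qed.
Let B0 : 0 <= B. Proof. by rewrite /B B_seqE divr_ge0// mulr_ge0// ltW. Qed.

(** This turns the factor [n] of [n f_n] into [k]. *)
Lemma one_sub_AB : 1 - A - B = n%:R / k.
Proof.
have nE : n%:R = k - (a n + b n) / 2 by rewrite /k addrK.
rewrite /A /B A_seqE B_seqE nE; move: (k) k0 => k' k0'.
by field; rewrite gt_eqF.
Qed.

Let AB0 : 0 < 1 - A - B. Proof. by rewrite one_sub_AB divr_gt0. Qed.

Let rad0 : 0 < (1 + A + B) * (1 - A - B) * (1 - A + B) * (1 + A - B).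
Proof.
have hA := A0; have hB := B0; have hAB := AB0.
apply: mulr_gt0; last lra.
apply: mulr_gt0; last lra.
by apply: mulr_gt0; last lra; lra.
Qed.

Let D0 : 0 < D_seq a b n. Proof. by rewrite /D_seq sqrtr_gt0. Qed.

Let D2 : D_seq a b n ^+ 2 = (1 + A + B) * (1 - A - B) * (1 - A + B) * (1 + A - B).
Proof. by rewrite /D_seq sqr_sqrtr// ltW. Qed.

Lemma r_lt_s : r_seq a b n < s_seq a b n.
Proof. by rewrite /r_seq /s_seq; have := D0; lra. Qed.

Let AB1 : B ^+ 2 <= 1 /\ A ^+ 2 <= 1.
Proof.
have hA := A0; have hB := B0; have hAB := AB0.
by split; rewrite exprn_ile1//; lra.
Qed.

(** The claim is [D^2 <= (1 - B^2 + A^2)^2], and the two sides differ by exactly [4 A^2]. *)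
Lemma s_seq_le1 : s_seq a b n <= 1.
Proof.
rewrite /s_seq -/A -/B -lerBrDl -ler_sqr ?nnegrE ?(ltW D0)//; last first.
  by have [? ?] := AB1; have := sqr_ge0 A; lra.
rewrite D2 -subr_ge0 [leRHS](_ : _ = 4 * A ^+ 2); last by ring.
by rewrite mulr_ge0// sqr_ge0.
Qed.

Lemma r_seq_geN1 : -1 <= r_seq a b n.
Proof.
rewrite /r_seq -/A -/B lerBrDl -lerBrDr -ler_sqr ?nnegrE ?(ltW D0)//; last first.
  by have [? ?] := AB1; have := sqr_ge0 B; lra.
rewrite D2 -subr_ge0 [leRHS](_ : _ = 4 * B ^+ 2); last by ring.
by rewrite mulr_ge0// sqr_ge0.
Qed.

(** The left-hand quadratic is [D^2 - (x - (B^2 - A^2))^2], in which the root in [D] disappears; the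
    rest is a rational identity. *)
Lemma bulk_quadratic (x : R) :
  k ^+ 2 * ((x - r_seq a b n) * (s_seq a b n - x)) =
  (k ^+ 2 - (a n + b n) ^+ 2 / 4) * (1 - x ^+ 2) - (b n - a n - (a n + b n) * x) ^+ 2 / 4.
Proof.
have -> : (x - r_seq a b n) * (s_seq a b n - x) =
    D_seq a b n ^+ 2 - (x - (B ^+ 2 - A ^+ 2)) ^+ 2.
  by rewrite /r_seq /s_seq -/A -/B; ring.
rewrite D2 /A /B A_seqE B_seqE; move: (a n) (b n) (k) k0 => a' b' k' k0'.
by field; rewrite gt_eqF.
Qed.

Lemma inv_n_f_seq (x : R) : 0 < (x - r_seq a b n) * (s_seq a b n - x) ->
  1 / (n%:R * f_seq a b n x) =
  pi * (1 - x ^+ 2) / (k * Num.sqrt ((x - r_seq a b n) * (s_seq a b n - x))).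
Proof.
move=> P0; have q0 : 0 < Num.sqrt ((x - r_seq a b n) * (s_seq a b n - x)).
  by rewrite sqrtr_gt0.
have X0 : 0 < 1 - x ^+ 2.
  by apply/one_sub_sqr_gt0/(P_gt0_itv r_lt_s r_seq_geN1 s_seq_le1 P0).
rewrite /f_seq -/A -/B one_sub_AB.
move: (Num.sqrt _) q0 (pi : R) (pi_gt0 R) => q q0 c c0.
by field; rewrite !gt_eqF.
Qed.

End DensityFacts.

(** * Limits of the turning points *)

Section DensityLimits.
Variables (R : realType) (a b : nat -> R) (alpha beta : R).
Hypotheses (halpha0 : 0 <= alpha) (hbeta0 : 0 <= beta).
Hypothesis halpha : alpha_seq a n @[n --> \oo] --> alpha.
Hypothesis hbeta : beta_seq b n @[n --> \oo] --> beta.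

Let S0 : 2 + alpha + beta != 0 :> R.
Proof. by rewrite gt_eqF//; have := halpha0; have := hbeta0; lra. Qed.

Let cvgS : (2 + alpha_seq a n + beta_seq b n) @[n --> \oo] --> 2 + alpha + beta.
Proof. by apply: cvgD => //; apply: cvgD => //; exact: cvg_cst. Qed.

Lemma cvg_A_seq : A_seq a b n @[n --> \oo] --> alpha / (2 + alpha + beta).
Proof. by apply: cvgM => //; exact: cvgV. Qed.

Lemma cvg_B_seq : B_seq a b n @[n --> \oo] --> beta / (2 + alpha + beta).
Proof. by apply: cvgM => //; exact: cvgV. Qed.

Lemma cvg_D_seq (A B : R) :
  A_seq a b n @[n --> \oo] --> A -> B_seq a b n @[n --> \oo] --> B ->
  D_seq a b n @[n --> \oo] -->
  Num.sqrt ((1 + A + B) * (1 - A - B) * (1 - A + B) * (1 + A - B)).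
Proof.
move=> hA hB.
have c1 : (1 : R) @[n --> \oo] --> (1 : R) by exact: cvg_cst.
apply: (@cvg_comp _ _ _ _ Num.sqrt); last exact: sqrt_continuous.
apply: cvgM; [apply: cvgM; [apply: cvgM|]|].
- by apply: cvgD => //; apply: cvgD.
- by apply: cvgB => //; apply: cvgB.
- by apply: cvgD => //; apply: cvgB.
- by apply: cvgB => //; apply: cvgD.
Qed.

Let cvg_c : exists c : R, (B_seq a b n ^+ 2 - A_seq a b n ^+ 2) @[n --> \oo] --> c.
Proof.
exists ((beta / (2 + alpha + beta)) * (beta / (2 + alpha + beta))
   - (alpha / (2 + alpha + beta)) * (alpha / (2 + alpha + beta))).
have hA := cvg_A_seq; have hB := cvg_B_seq.
by apply: cvgB; apply: cvgM.
Qed.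

(** As [r_lim] is a [limn], convergence to some value suffices. *)
Lemma cvg_r_seq : r_seq a b n @[n --> \oo] --> r_lim a b.
Proof.
have [c hc] := cvg_c; apply: cvgP.
by apply: cvgB; [exact: hc|exact: (cvg_D_seq cvg_A_seq cvg_B_seq)].
Qed.

Lemma cvg_s_seq : s_seq a b n @[n --> \oo] --> s_lim a b.
Proof.
have [c hc] := cvg_c; apply: cvgP.
by apply: cvgD; [exact: hc|exact: (cvg_D_seq cvg_A_seq cvg_B_seq)].
Qed.

(* On [X] the limiting quadratic is bounded below by compactness; the one at
   finite [n] differs from it by [O(|r_n - r| + |s_n - s|)]. *)
Lemma bulk_quadratic_ge (X : set R) : compact X ->
  X `<=` `](r_lim a b), (s_lim a b)[ ->
  exists2 p0 : R, 0 < p0 & \forall n \near \oo, forall x, X x ->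
    p0 <= (x - r_seq a b n) * (s_seq a b n - x).
Proof.
move=> cX Xrs; have [->|X0] := eqVneq X set0.
  by exists 1 => //; near=> n => x.
set r := r_lim a b in Xrs; set s := s_lim a b in Xrs.
pose g x := (x - r) * (s - x).
have cg : {within X, continuous g}.
  apply: continuous_subspaceT => x.
  have dg : is_derive x 1 g (s + r - 2 * x) by rewrite /g; is_derive_tac; ring.
  exact: is_derive_cont dg.
move/set0P in X0; have [c + gmin] := compact_EVT_min X0 cX cg.
rewrite inE => /Xrs; rewrite /= in_itv/= => /andP[rc cs].
have g0 : 0 < g c by rewrite mulr_gt0// subr_gt0.
have L0 : 0 < s - r by lra.
(* The perturbation costs at most [2 e (s - r) + e^2]; by [e <= 1] and the second bound this is at
   most [g c / 2]. *)
pose e := Num.min 1 (g c / (2 * (2 * (s - r) + 1))).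
have e0 : 0 < e by rewrite lt_min ltr01 divr_gt0//; lra.
exists (g c / 2); first by lra.
have hr := cvg_r_seq; have hs := cvg_s_seq.
near=> n => x Xx.
have er : `|r - r_seq a b n| <= e.
  by near: n; move/cvgrPdist_le : hr; exact.
have es : `|s - s_seq a b n| <= e.
  by near: n; move/cvgrPdist_le : hs; exact.
have := gmin x (mem_set Xx); rewrite {2}/g => gx.
have := Xrs x Xx; rewrite /= in_itv/= => /andP[rx xs].
have e1 : e <= 1 by rewrite ge_min lexx.
have eg : e * (2 * (2 * (s - r) + 1)) <= g c.
  rewrite -ler_pdivlMr; last lra.
  by rewrite ge_min lexx orbT.
move: er es; rewrite !ler_norml => /andP[r1 r2] /andP[s1 s2].
set rn := r_seq a b n in r1 r2 *; set sn := s_seq a b n in s1 s2 *.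
have -> : (x - rn) * (sn - x) = (x - r) * (s - x) + (r - rn) * (s - x)
  - (x - r) * (s - sn) - (r - rn) * (s - sn) by ring.
have b1 : - (e * (s - r)) <= (r - rn) * (s - x) by nra.
have b2 : (x - r) * (s - sn) <= e * (s - r) by nra.
have b3 : (r - rn) * (s - sn) <= e by nra.
by lra.
Unshelve. all: by end_near. Qed.

End DensityLimits.

Theorem theorem4p5 (R : realType) (p : R -> R -> nat -> {poly R})
    (hp : forall a b : R, 0 <= a -> 0 <= b -> jacobi_orthonormal a b (p a b))
    (a b : nat -> R) (ha : forall n, 0 <= a n) (hb : forall n, 0 <= b n)
    (alpha beta : R) (halpha0 : 0 <= alpha) (hbeta0 : 0 <= beta)
    (halpha : alpha_seq a n @[n --> \oo] --> alpha)
    (hbeta : beta_seq b n @[n --> \oo] --> beta)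
    (X U V : set R) (hX : compact X)
    (hXrs : X `<=` `](r_lim a b), (s_lim a b)[)
    (hU : compact U) (hV : compact V) :
  exists C : R, \forall n \near \oo, forall x u v : R, X x -> U u -> V v ->
    `| 1 / (n%:R * f_seq a b n x) *
       jacobi_kernel (a n) (b n) (p (a n) (b n)) n
         (x + u / (n%:R * f_seq a b n x)) (x + v / (n%:R * f_seq a b n x))
       - sinc (u - v) | <= C * n%:R^-1.
Proof.
have [p0 p00 hP] := bulk_quadratic_ge halpha0 hbeta0 halpha hbeta hX hXrs.
have bnd (W : set R) : compact W -> exists2 T : R, 0 <= T & forall w, W w -> `|w| <= T.
  move=> /compact_bounded[M [Mr hM]]; exists (Num.max 0 (M + 1)) => [|w Ww].
    by rewrite le_max lexx.
  by apply: le_trans (hM (M + 1) _ _ Ww) _; rewrite ?le_max ?lexx ?orbT// ltrDl.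
have [T1 T10 hT1] := bnd _ hU; have [T2 T20 hT2] := bnd _ hV.
pose T := Num.max T1 T2.
have T0 : 0 <= T by rewrite le_max T10.
(* The absolute value provides the nonnegative constant needed to pass from [1 / k] to [1 / n]. *)
exists `|sine_error p0 T|; near=> n => x u v Xx Uu Vv.
have n0 : (0 < n)%N by near: n; exact: nbhs_infty_gt.
have Pn : p0 <= (x - r_seq a b n) * (s_seq a b n - x).
  (* The point is generalized first, so that the threshold on [n] does not depend on it. *)
  by move: x Xx {u v Uu Vv}; near: n.
have nK : sine_threshold p0 T <= n%:R by near: n; exact: nbhs_infty_ger.
have uT : `|u| <= T by rewrite le_max hT1.
have vT : `|v| <= T by rewrite le_max hT2 ?orbT.
have nk : n%:R <= n%:R + (a n + b n) / 2 :> R by rewrite lerDl divr_ge0// addr_ge0.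
have kK := le_trans nK nk.
have := bulk_sine_kernel p00 T0 (ha n) (hb n) (hp _ _ (ha n) (hb n)) n0
  (r_lt_s ha hb n0) (r_seq_geN1 ha hb n0) (s_seq_le1 ha hb n0)
  (bulk_quadratic ha hb n0) kK Pn uT vT.
rewrite -(inv_n_f_seq ha hb n0) ?(lt_le_trans p00)// !div1r.
move=> h; apply: (le_trans h).
have N0 : 0 < n%:R :> R by rewrite ltr0n.
apply: (@le_trans _ _ (`|sine_error p0 T| / (n%:R + (a n + b n) / 2))).
  by rewrite ler_wpM2r ?ler_norm// invr_ge0 (le_trans _ nk)// ltW.
by rewrite ler_wpM2l// lef_pV2// posrE (lt_le_trans N0).
Unshelve. all: by end_near. Qed.
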